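(* Let $d\in\mathbb{N}$, let $M\in\mathcal{S}^d$ and $\Psi,\Sigma\in\mathcal{S}_{++}^d$ be such that $\Psi\Sigma=\Sigma\Psi$. Let $\mathfrak{Z}\sim\mathcal{SN}_{d\times d}(M,\Psi,\Sigma)$ and define $$\mathcal{C}:=\Big\{f\in C^2(\mathcal{S}^d):\ \mathsf{E}\big[|\mathrm{tr}\{(M-\mathfrak{Z})\nabla f(\mathfrak{Z})\}|\big]<\infty,\ \ \mathsf{E}\big[|\mathrm{tr}\{\Psi\nabla\Sigma\nabla f(\mathfrak{Z})\}|\big]<\infty\Big\}.$$ For $f\in C^2(\mathcal{S}^d)$ let $$\mathcal{A}f(S):=\mathrm{tr}\{(M-S)\nabla f(S)\}+\mathrm{tr}\{\Psi\nabla\Sigma\nabla f(S)\},\qquad S\in\mathcal{S}^d.$$ Then an $\mathcal{S}^d$-valued random matrix $\mathfrak{X}$ satisfies $\mathfrak{X}\sim\mathcal{SN}_{d\times d}(M,\Psi,\Sigma)$ if and only if $\mathsf{E}[\mathcal{A}f(\mathfrak{X})]=0$ (in particular, the expectation exists) for every $f\in\mathcal{C}$.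
   Context: $\mathcal{S}^d$ and $\mathcal{S}_{++}^d$ are the sets of real symmetric and of real symmetric positive definite $d\times d$ matrices; $\mathcal{S}^d$ carries the Frobenius inner product $\langle A,B\rangle_F=\mathrm{tr}(A^\top B)$ and norm $\|\cdot\|_F$. $C^2(\mathcal{S}^d)$ is the class of twice continuously differentiable functions $\mathcal{S}^d\to\mathbb{R}$, and $D^kf(S)[U_1,\ldots,U_k]$ is the $k$-th Fréchet derivative evaluated in directions $U_1,\ldots,U_k\in\mathcal{S}^d$. The symmetric gradient $\nabla f(S)\in\mathcal{S}^d$ is characterized by $Df(S)[U]=\mathrm{tr}\{U\nabla f(S)\}$ for all $U\in\mathcal{S}^d$. For $f\in C^2(\mathcal{S}^d)$, with $e_1,\dots,e_d$ the standard basis of $\mathbb{R}^d$ and $\Psi^{1/2},\Sigma^{1/2}$ the symmetric positive definite square roots, the second-order differential expression is $$\mathrm{tr}\{\Psi\nabla\Sigma\nabla f(S)\}:=\frac14\sum_{i,j=1}^d D^2f(S)\big[V_{ij},V_{ij}\big],\qquad V_{ij}:=\Psi^{1/2}e_ie_j^\top\Sigma^{1/2}+\Sigma^{1/2}e_je_i^\top\Psi^{1/2}.$$ Symmetric matrix normal distribution: let $q_d=d(d+1)/2$, fix an ordering $\{(i_a,j_a):a\in\{1,\dots,q_d\}\}$ of $\{(i,j):1\le i\le j\le d\}$, and let $\mathrm{vecs}(S)=(r_aS_{i_aj_a})_{a}\in\mathbb{R}^{q_d}$ with $r_a=1$ if $i_a=j_a$ and $r_a=\sqrt2$ if $i_a<j_a$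 (an isometry from $\mathcal{S}^d$ onto $\mathbb{R}^{q_d}$). Let $E_a\in\mathcal{S}^d$ be the matrix with $\mathrm{vecs}(E_a)$ equal to the $a$-th standard basis vector of $\mathbb{R}^{q_d}$. For commuting $\Psi,\Sigma\in\mathcal{S}_{++}^d$, let $\Omega_{\Psi,\Sigma}$ be the $q_d\times q_d$ matrix with entries $(\Omega_{\Psi,\Sigma})_{ab}=\langle K_{\Psi,\Sigma}E_a,E_b\rangle_F$, where $K_{\Psi,\Sigma}U=(\Psi U\Sigma+\Sigma U\Psi)/2$. A random matrix $\mathfrak{Z}\in\mathcal{S}^d$ has law $\mathcal{SN}_{d\times d}(M,\Psi,\Sigma)$ if $\mathrm{vecs}(\mathfrak{Z})\sim\mathcal{N}_{q_d}(\mathrm{vecs}(M),\Omega_{\Psi,\Sigma})$. *)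

(* Defs.v *)
From HB Require Import structures.
From mathcomp Require Import all_boot all_order all_algebra.
From mathcomp Require Import all_classical all_reals all_analysis.
From mathcomp Require Import ring.

Set Implicit Arguments.
Unset Strict Implicit.
Unset Printing Implicit Defensive.

Import Order.TTheory GRing.Theory Num.Theory.
Import numFieldNormedType.Exports.

Local Open Scope classical_set_scope.
Local Open Scope ring_scope.

Definition symm_pred (R : pzRingType) (d : nat) : {pred 'M[R]_d} :=
  fun S => S^T == S.

Lemma symm_submod_closed (R : pzRingType) (d : nat) :
  submod_closed (@symm_pred R d).
Proof.
split=> [|a A B]; rewrite !unfold_in /symm_pred; first by rewrite trmx0.
by move=> /eqP hA /eqP hB; rewrite linearP /= hA hB.
Qed.

HB.instance Definition _ (R : pzRingType) (d : nat) :=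
  GRing.isSubmodClosed.Build R 'M[R]_d (@symm_pred R d)
    (@symm_submod_closed R d).

Record symmx (R : realType) (d : nat) := SymMx {
  symval :> 'M[R]_d;
  _ : symval \in @symm_pred R d }.

Section SymMatrices.
Variables (R : realType) (d : nat).

HB.instance Definition _ := [isSub for @symval R d].
HB.instance Definition _ := [Choice of symmx R d by <:].
HB.instance Definition _ := [SubChoice_isSubLmodule of symmx R d by <:].

Lemma symmxT (S : symmx R d) : (S : 'M[R]_d)^T = S.
Proof. by case: S => S /= /eqP. Qed.

Definition frob_dot (A B : 'M[R]_d) : R := \tr (A^T *m B).

Definition frob_norm (S : symmx R d) : R := Num.sqrt (frob_dot S S).

Lemma frob_dotC A B : frob_dot A B = frob_dot B A.
Proof. by rewrite /frob_dot -mxtrace_tr trmx_mul trmxK. Qed.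

Lemma frob_dotDl A B C : frob_dot (A + B) C = frob_dot A C + frob_dot B C.
Proof. by rewrite /frob_dot linearD /= mulmxDl mxtraceD. Qed.

Lemma frob_dotZl a A B : frob_dot (a *: A) B = a * frob_dot A B.
Proof. by rewrite /frob_dot linearZ /= -scalemxAl mxtraceZ. Qed.

Lemma frob_dotE A : frob_dot A A = \sum_i \sum_j A j i ^+ 2.
Proof.
rewrite /frob_dot /mxtrace; apply: eq_bigr => i _; rewrite mxE.
by apply: eq_bigr => j _; rewrite mxE expr2.
Qed.

Lemma frob_dot_ge0 A : 0 <= frob_dot A A.
Proof.
by rewrite frob_dotE; do 2 apply: sumr_ge0 => ? _; exact: sqr_ge0.
Qed.

Lemma frob_dot_eq0 A : frob_dot A A = 0 -> A = 0.
Proof.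
rewrite frob_dotE => /eqP; rewrite psumr_eq0; last first.
  by move=> i _; apply: sumr_ge0 => j _; exact: sqr_ge0.
move=> /allP h; apply/matrixP => j i; rewrite mxE.
have /implyP/(_ isT) := h i (mem_index_enum i).
rewrite psumr_eq0; last by move=> k _; exact: sqr_ge0.
move=> /allP /(_ j (mem_index_enum j)) /implyP /(_ isT).
by rewrite sqrf_eq0 => /eqP.
Qed.

Lemma frob_CauchySchwarz A B :
  frob_dot A B ^+ 2 <= frob_dot A A * frob_dot B B.
Proof.
set a := frob_dot A A; set b := frob_dot B B; set c := frob_dot A B.
have [b0|b0] := eqVneq b 0.
  have B0 := frob_dot_eq0 b0.
  suff -> : c = 0 by rewrite expr0n /= b0 mulr0.
  by rewrite /c B0 /frob_dot mulmx0 mxtrace0.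
have bpos : 0 < b by rewrite lt_neqAle eq_sym b0 frob_dot_ge0.
have := frob_dot_ge0 (b *: A + (- c) *: B).
rewrite frob_dotDl !frob_dotZl ![frob_dot _ (_ + _)]frob_dotC.
rewrite !frob_dotDl !frob_dotZl [frob_dot B A]frob_dotC -/a -/b -/c.
rewrite (_ : _ + _ = b * (a * b - c ^+ 2)); last by ring.
by rewrite pmulr_rge0// subr_ge0.
Qed.

Lemma frob_normD (S T : symmx R d) :
  frob_norm (S + T) <= frob_norm S + frob_norm T.
Proof.
rewrite -ler_sqr ?nnegrE ?addr_ge0 ?sqrtr_ge0//.
rewrite sqrrD !sqr_sqrtr ?frob_dot_ge0//=.
rewrite frob_dotDl ![frob_dot _ (_ + _)]frob_dotC !frob_dotDl.
rewrite [frob_dot (symval T) (symval S)]frob_dotC.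
set a := frob_dot _ _; set c := frob_dot _ _; set b := frob_dot _ _.
suff : c <= frob_norm S * frob_norm T.
  by move=> h; rewrite (_ : a + c + (c + b) = a + b + c *+ 2) ?mulr2n; [|ring];
     rewrite [leRHS]addrAC lerD2l lerD.
rewrite /frob_norm -sqrtrM ?frob_dot_ge0// (le_trans (ler_norm _))//.
rewrite -sqrtr_sqr ler_sqrt ?mulr_ge0 ?frob_dot_ge0//.
exact: frob_CauchySchwarz.
Qed.

Lemma frob_normZ (a : R) (S : symmx R d) :
  frob_norm (a *: S) = `|a| * frob_norm S.
Proof.
rewrite /frob_norm /= frob_dotZl frob_dotC frob_dotZl mulrA -expr2.
by rewrite sqrtrM ?sqr_ge0// sqrtr_sqr.
Qed.

Lemma frob_norm_eq0 (S : symmx R d) : frob_norm S = 0 -> S = 0.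
Proof.
move=> /eqP; rewrite sqrtr_eq0 => h; apply/val_inj/frob_dot_eq0.
by apply/le_anti; rewrite h frob_dot_ge0.
Qed.

HB.instance Definition _ := @Lmodule_isNormed.Build R (symmx R d)
  (@frob_norm) frob_normD frob_normZ frob_norm_eq0.

(* Borel sigma-algebra *)
HB.instance Definition _ := @isMeasurable.Build
  (sigma_display (@open (symmx R d))) (symmx R d)
  <<s (@open (symmx R d)) >> (@sigma_algebra0 _ setT _)
  (@sigma_algebraC (symmx R d) _) (@sigma_algebra_bigcup _ setT _).

End SymMatrices.

Section TupleLebesgue.
Variables (R : realType) (n : nat).
Variable mu : {sigma_finite_measure set (n.-tuple (measurableTypeR R)) -> \bar R}.

Definition tcons (p : measurableTypeR R * n.-tuple (measurableTypeR R)) :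
    n.+1.-tuple (measurableTypeR R) := [tuple of p.1 :: p.2].

Lemma measurable_tcons : measurable_fun setT tcons.
Proof. exact: measurable_cons. Qed.

Definition cons_measure : set (n.+1.-tuple (measurableTypeR R)) -> \bar R :=
  pushforward (@lebesgue_measure R \x mu)%E tcons.

Let cons_measure0 : cons_measure set0 = 0%E.
Proof. by rewrite /cons_measure /pushforward preimage_set0 measure0. Qed.

Let cons_measure_ge0 A : (0 <= cons_measure A)%E.
Proof. exact: (measure_ge0 (@lebesgue_measure R \x mu)%E). Qed.

Let cons_measure_sigma_additive : semi_sigma_additive cons_measure.
Proof.
move=> F mF tF mUF; rewrite /cons_measure /pushforward preimage_bigcup.
apply: measure_semi_sigma_additive.
- by move=> k; rewrite -[X in measurable X]setTI; exact: measurable_tcons.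
- apply/trivIsetP => /= i j _ _ ij; rewrite -preimage_setI.
  by move/trivIsetP : tF => /(_ _ _ _ _ ij) ->//; rewrite preimage_set0.
- by rewrite -preimage_bigcup -[X in measurable X]setTI; exact: measurable_tcons.
Qed.

HB.instance Definition _ := isMeasure.Build _ _ _ cons_measure
  cons_measure0 cons_measure_ge0 cons_measure_sigma_additive.

Let cons_measure_sigma_finite : sigma_finite setT cons_measure.
Proof.
have /sigma_finiteP[F [FT ndF Foo]] :=
  sigma_finiteT (@lebesgue_measure R : {sigma_finite_measure set _ -> \bar R}).
have /sigma_finiteP[G [GT ndG Goo]] := sigma_finiteT mu.
pose u (t : n.+1.-tuple (measurableTypeR R)) :
  measurableTypeR R * n.-tuple (measurableTypeR R) :=
  (tnth t ord0, [tuple of behead t]).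
have mu_ : measurable_fun setT u.
  by apply: measurable_fun_pair; [exact: measurable_tnth|exact: measurable_behead].
have uK p : u (tcons p) = p.
  by case: p => x t; rewrite /u /tcons; congr pair; exact/val_inj.
exists (fun k => u @^-1` (F k `*` G k)).
  apply/esym; rewrite -subTset => t _.
  have : setT (u t).1 by [].
  have : setT (u t).2 by [].
  rewrite {1}FT {1}GT => -[k _ Gk] [l _ Fl]; exists (maxn k l) => //; split.
  - by move: Fl; exact/subsetPset/ndF/leq_maxr.
  - by move: Gk; exact/subsetPset/ndG/leq_maxl.
move=> k; have [mF Fk] := Foo k; have [mG Gk] := Goo k; split.
  rewrite -[X in measurable X]setTI; apply: mu_ => //.
  exact: measurableX.
rewrite /cons_measure /pushforward -comp_preimage.
rewrite (_ : u \o tcons = id); last by apply/funext => p /=; rewrite uK.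
rewrite preimage_id product_measure1E//.
by rewrite lte_mul_pinfty// ge0_fin_numE.
Qed.

HB.instance Definition _ := Measure_isSigmaFinite.Build _ _ _ cons_measure
  cons_measure_sigma_finite.

End TupleLebesgue.

(* Lebesgue measure on R^n, as the n-fold product of the one on R. *)
Fixpoint tuple_lebesgue (R : realType) (n : nat) :
    {sigma_finite_measure set (n.-tuple (measurableTypeR R)) -> \bar R} :=
  if n is m.+1 then @cons_measure R m (tuple_lebesgue R m)
  else \d_ ([tuple] : 0.-tuple (measurableTypeR R)).

Section SecondOrder.
Variables (R : realType) (V : normedModType R).
Implicit Types (f : V -> R) (S T U W : V).

Definition D2 f S U W : R := 'd (fun T => 'd f T U) S W.

(* V is meant to be finite-dimensional, so that all linear forms are bounded.
   The last two conditions say, with the operator norms written out, that the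
   map S |-> 'd f S into the dual of V is Frechet differentiable with derivative
   D2 f, and that S |-> D2 f S is continuous. *)
Definition C2 f : Prop :=
  [/\ forall S, differentiable f S,
      forall S (e : R), 0 < e -> \forall H \near (0 : V), forall U,
        `|'d f (S + H) U - 'd f S U - D2 f S U H| <= e * `|H| * `|U| &
      forall S (e : R), 0 < e -> \forall T \near S, forall U W,
        `|D2 f T U W - D2 f S U W| <= e * `|U| * `|W|].

End SecondOrder.

Section SteinOperator.
Variables (R : realType) (d : nat).
Implicit Types (f : symmx R d -> R) (S M Psi Sigma : symmx R d).

Definition posdef S : Prop :=
  forall x : 'rV[R]_d, x != 0 -> 0 < (x *m S *m x^T) 0 0.

(* Every positive definite S has exactly one positive definite square root, so
   [get] is unambiguous on such S; its value elsewhere is irrelevant. *)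
Definition sqrt_sym S : symmx R d :=
  get (fun B : symmx R d => posdef B /\ B *m B = S :> 'M[R]_d).

(* The Riesz representative of 'd f S, see gradP. *)
Definition grad f S : symmx R d :=
  get (fun G : symmx R d => forall U : symmx R d, 'd f S U = \tr (U *m G)).

Lemma gradP f S (U : symmx R d) : 'd f S U = \tr (U *m grad f S).
Proof.
move: U; apply: (@getPex _ (fun G : symmx R d =>
  forall U : symmx R d, 'd f S U = \tr (U *m G))).
have sB i j :
    (2^-1 *: (delta_mx i j + delta_mx j i) : 'M[R]_d) \in @symm_pred R d.
  by rewrite unfold_in /symm_pred linearZ /= linearD /= !trmx_delta addrC.
pose B i j := SymMx (sB i j).
have sG : (\matrix_(i, j) 'd f S (B i j)) \in @symm_pred R d.
  rewrite unfold_in /symm_pred; apply/eqP/matrixP => i j; rewrite !mxE.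
  by congr ('d f S _); apply: val_inj; rewrite /= addrC.
exists (SymMx sG) => U.
have UE : U = \sum_i \sum_j (U : 'M[R]_d) i j *: B i j.
  have sum_val (F : 'I_d -> symmx R d) :
      symval (\sum_i F i) = \sum_i symval (F i).
    by apply: (big_morph (@symval R d)).
  apply: val_inj; rewrite /= sum_val.
  under eq_bigr do rewrite sum_val /=.
  have -> : \sum_i \sum_j U i j *: (2^-1 *: (delta_mx i j + delta_mx j i)) =
      2^-1 *: (\sum_i \sum_j U i j *: delta_mx i j +
               (\sum_i \sum_j U i j *: delta_mx i j)^T) :> 'M[R]_d.
    rewrite [(_)^T]linear_sum -big_split scaler_sumr; apply: eq_bigr => i _ /=.
    rewrite [(_)^T]linear_sum -big_split scaler_sumr; apply: eq_bigr => j _ /=.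
    by rewrite [(_)^T]linearZ /= trmx_delta -scalerDr !scalerA mulrC.
  rewrite -matrix_sum_delta symmxT -mulr2n.
  rewrite -[X in _ *: X]scaler_nat scalerA mulVf ?scale1r//.
rewrite [in LHS]UE linear_sum /mxtrace; apply: eq_bigr => i _.
rewrite linear_sum mxE; apply: eq_bigr => j _.
rewrite linearZ /= !mxE; congr (_ * 'd f S _).
by apply: val_inj; rewrite /= addrC.
Qed.

Lemma Vdir_subproof (P Q : symmx R d) (i j : 'I_d) :
  (P *m delta_mx i j *m Q + Q *m delta_mx j i *m P : 'M[R]_d) \in @symm_pred R d.
Proof.
by rewrite unfold_in /symm_pred linearD /= !trmx_mul !trmx_delta !symmxT
           !mulmxA addrC.
Qed.

Definition Vdir Psi Sigma (i j : 'I_d) : symmx R d :=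
  SymMx (Vdir_subproof (sqrt_sym Psi) (sqrt_sym Sigma) i j).

(* tr{Psi nabla Sigma nabla f(S)} *)
Definition tr_PsiSigma Psi Sigma f S : R :=
  4^-1 * \sum_i \sum_j D2 f S (Vdir Psi Sigma i j) (Vdir Psi Sigma i j).

Definition tr_drift M f S : R := \tr ((M - S : symmx R d) *m grad f S).

Definition stein_op M Psi Sigma f S : R :=
  tr_drift M f S + tr_PsiSigma Psi Sigma f S.

End SteinOperator.

Definition qdim (d : nat) : nat := (d * d.+1)./2.

(* Enumerations a |-> (i_a, j_a) of the pairs i <= j. *)
Definition sym_ordering (d : nat) (idx : 'I_(qdim d) -> 'I_d * 'I_d) : Prop :=
  injective idx /\ range idx = [set p : 'I_d * 'I_d | (p.1 <= p.2)%N].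

Section Vecs.
Variables (R : realType) (d : nat) (idx : 'I_(qdim d) -> 'I_d * 'I_d).

Definition vecs_wt (a : 'I_(qdim d)) : R :=
  if (idx a).1 == (idx a).2 then 1 else Num.sqrt 2.

Definition vecs (S : symmx R d) : (qdim d).-tuple (measurableTypeR R) :=
  [tuple vecs_wt a * S (idx a).1 (idx a).2 | a < qdim d].

Lemma symE_subproof (a : 'I_(qdim d)) :
  (\matrix_(i, j) (if ((i, j) == idx a) || ((j, i) == idx a)
                   then (vecs_wt a)^-1 else 0)) \in @symm_pred R d.
Proof.
by rewrite unfold_in /symm_pred; apply/eqP/matrixP => i j; rewrite !mxE orbC.
Qed.

Definition symE (a : 'I_(qdim d)) : symmx R d := SymMx (symE_subproof a).

Lemma vecs_symE (a b : 'I_(qdim d)) :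
  sym_ordering idx -> tnth (vecs (symE a)) b = (b == a)%:R.
Proof.
move=> [inj rg]; rewrite tnth_mktuple mxE.
have le c : ((idx c).1 <= (idx c).2)%N.
  have : range idx (idx c) by exists c.
  by rewrite rg.
have wt0 : vecs_wt a != 0.
  by rewrite /vecs_wt; case: ifP => _; rewrite ?oner_neq0// sqrtr_eq0 -ltNge.
have [->|ba] := eqVneq b a.
  by rewrite -surjective_pairing eqxx /= mulfV.
rewrite -surjective_pairing (inj_eq inj) (negbTE ba) /=.
case: eqP => [h|_]; last by rewrite mulr0.
case/eqP: ba; apply: inj; move: (le a); rewrite -h /= => le'.
have e : (idx b).1 = (idx b).2 by apply/val_inj/anti_leq; rewrite le le'.
by rewrite [LHS]surjective_pairing e.
Qed.

Definition covK (Psi Sigma : symmx R d) (U : 'M[R]_d) : 'M[R]_d :=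
  2^-1 *: (Psi *m U *m Sigma + Sigma *m U *m Psi).

Definition Omega (Psi Sigma : symmx R d) : 'M[R]_(qdim d) :=
  \matrix_(a, b) frob_dot (covK Psi Sigma (symE a)) (symE b).

End Vecs.

(* Density of N_q(mu, Om); meaningful for Om symmetric positive definite. *)
Definition mvn_pdf (R : realType) (q : nat) (mu : q.-tuple (measurableTypeR R))
    (Om : 'M[R]_q) (y : q.-tuple (measurableTypeR R)) : R :=
  let z : 'rV[R]_q := \row_a (tnth y a - tnth mu a) in
  (Num.sqrt ((2 * pi) ^+ q * \det Om))^-1 *
  expR (- (z *m invmx Om *m z^T) 0 0 / 2).

Definition has_law_mvn (R : realType) (dT : measure_display)
    (T : measurableType dT) (P : probability T R) (q : nat)
    (Y : T -> q.-tuple (measurableTypeR R))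
    (mu : q.-tuple (measurableTypeR R)) (Om : 'M[R]_q) : Prop :=
  forall A : set (q.-tuple (measurableTypeR R)), measurable A ->
    P (Y @^-1` A) = (\int[tuple_lebesgue R q]_(y in A) (mvn_pdf mu Om y)%:E)%E.

Section SymNormal.
Variables (R : realType) (d : nat) (idx : 'I_(qdim d) -> 'I_d * 'I_d).
Variables (dT : measure_display) (T : measurableType dT) (P : probability T R).
Variable X : {RV P >-> symmx R d}.
Variables M Psi Sigma : symmx R d.

Definition has_law_SN : Prop :=
  has_law_mvn P (vecs idx \o X) (vecs idx M) (Omega idx Psi Sigma).

Definition stein_class (f : symmx R d -> R) : Prop :=
  [/\ C2 f,
      ('E_P[fun w => `|tr_drift M f (X w)|%R] < +oo)%E &
      ('E_P[fun w => `|tr_PsiSigma Psi Sigma f (X w)|%R] < +oo)%E].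

End SymNormal.

(* Main.v *)
(** Necessity. In coordinates the law has density proportional to exp(-Q/2), with
    Q the Mahalanobis form of the covariance matrix Om. Multiply the density by
    the cut-off (1 - kQ)_+^2 and let F_a be the product with sum_b Om_ab D_b f. The
    divergence of the compactly supported field F integrates to 0. As the cut-off
    depends on Q only, its gradient contributes a multiple of k times the drift
    tr{(M - S) grad f(S)}, which is integrable, so k -> 0 gives E[A f] = 0.

    Sufficiency. Let U be a centred linear form of S with variance kappa. On
    cos(a U + b), A acts as -a (d/da + a kappa), so E[A f] = 0 for these f makes
    E cos(a U + b) a solution of y' = - a kappa y; hence E cos(U + b) =
    exp(-kappa/2) cos b. These expectations determine the law: the class of
    functions generated by the cosines under linear combinations and bounded
    pointwise limits is closed under products and contains the indicators of
    half-spaces, because the sign function is a limit of polynomials in sines. *)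

Require Import Defs.
From HB Require Import structures.
From mathcomp Require Import all_boot all_order all_algebra.
From mathcomp Require Import all_classical all_reals all_analysis.
From mathcomp Require Import measurable_realfun.
From mathcomp Require Import complex ring lra.

Set Implicit Arguments.
Unset Strict Implicit.
Unset Printing Implicit Defensive.

Import Order.TTheory GRing.Theory Num.Theory.
Import numFieldNormedType.Exports.

Local Open Scope classical_set_scope.
Local Open Scope ring_scope.

(** The analysis takes place in a normed space with a basis [e] and coordinates [x]; matrices enter
    only through the identity that turns tr{Psi nabla Sigma nabla f} into sum_ab Om_ab D^2
    f[E_a, E_b]. Two integrability questions shape the proof. The class of test functions is defined
    by the law of Z, so the cosines have to be shown to belong to it, which needs E|U| under Z. No
    Gaussian moment is computed for this: the truncated identity for the square of U bounds E U^2
    uniformly in the cut-off. For X no moment is given at all, while differentiating E cos(a U + b)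
    in a requires E|U|. It is extracted from the Stein identities themselves, with the phases 0 and
    pi/2, because |sin u| + |cos u| >= 1. The normalising constant of the density is never
    evaluated: it factors out of integrals that vanish. The end of sufficiency compares X with Z,
    which has the required law by assumption. *)

(** * Square roots of positive definite matrices *)

Lemma poly_interpolation (F : fieldType) (s : seq F) (g : F -> F) :
  uniq s -> exists p : {poly F}, {in s, forall x, p.[x] = g x}.
Proof.
elim: s => [|a s IH] /= => [_|/andP[a_s /IH[p hp]]]; first by exists 0.
pose w := \prod_(y <- s) ('X - y%:P).
have wa : w.[a] != 0 by rewrite -[_ == _]/(root w a) root_prod_XsubC.
exists (p + ((g a - p.[a]) / w.[a])%:P * w) => x.
rewrite inE !hornerE => /orP[/eqP ->|xs]; first by rewrite divfK// addrC subrK.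
have /rootP -> : root w x by rewrite root_prod_XsubC.
by rewrite mulr0 addr0 hp.
Qed.

Section SquareRoot.
Variable R : realType.

(** [A] is Hermitian over [R[i]], so the complex spectral theorem applies and the eigenvalues are
    real. The conjugating matrix [P] remains complex. *)
Lemma symmetric_spectral_decomposition (d : nat) (A : 'M[R]_d) : A^T = A ->
  exists (P : 'M[R[i]]_d) (r : 'rV[R]_d), P \in unitmx /\
    map_mx (real_complex R) A =
      invmx P *m diag_mx (map_mx (real_complex R) r) *m P.
Proof.
move=> symA; set AC := map_mx _ A.
have hA : AC \is hermsymmx.
  apply/is_hermitianmxP; rewrite expr0 scale1r /AC map_trmx symA -map_mx_comp.
  by apply/matrixP => i j; rewrite !mxE /=; apply/esym/CrealP/complex_realP; eexists.
have /orthomx_spectralP AE := hermitian_normalmx hA.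
have /mxOverP D_real := hermitian_spectral_diag_real hA.
exists (spectralmx AC), (map_mx (fun z : R[i] => complex.Re z) (spectral_diag AC)).
split; first exact: spectral_unit.
rewrite -map_mx_comp [X in diag_mx X](_ : _ = spectral_diag AC) //.
by apply/rowP => i; rewrite !mxE /= RRe_real.
Qed.

(* The square root of A must itself be positive definite; being the square of a
   symmetric invertible C, it is. *)
Lemma posdef_fourth_root (d : nat) (A : symmx R d) : posdef A ->
  exists C : symmx R d, (C *m C) *m (C *m C) = A :> 'M[R]_d.
Proof.
case: d A => [|d] A pA; first by exists A; apply/matrixP => -[].
have [P [r [Pu AE]]] := symmetric_spectral_decomposition (symmxT A).
have r_gt0 i : 0 < r 0 i.
  (* Being an eigenvalue descends from [R[i]] to [R]. This provides a real eigenvector to insert in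
     [posdef], although the rows of [P] are complex. *)
  have : eigenvalue (symval A) (r 0 i).
    rewrite -(eigenvalue_map (real_complex R)).
    apply/eigenvalueP; exists (row i P).
      rewrite AE -row_mul mulmxA mulmxA mulmxV // mul1mx row_mul row_diag_mx.
      by rewrite -scalemxAl -rowE mxE.
    apply: contraTneq Pu => Pi0.
    apply/negP => /mulmxV /matrixP /(_ i i); rewrite !mxE eqxx big1 => [/eqP|j _].
      by rewrite eq_sym oner_eq0.
    by have /rowP/(_ j) := Pi0; rewrite !mxE => ->; rewrite mul0r.
  move=> /eigenvalueP[v vA v0]; have := pA _ v0.
  rewrite vA -scalemxAl mxE pmulr_lgt0// mxE.
  rewrite lt_neqAle sumr_ge0 ?andbT => [|j _]; last by rewrite mxE -expr2 sqr_ge0.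
  apply: contra v0 => /eqP/esym/eqP.
  rewrite psumr_eq0 => [/allP v0|j _]; last by rewrite mxE -expr2 sqr_ge0.
  apply/eqP/rowP => j; have /v0 := mem_index_enum j.
  by rewrite /= !mxE mulf_eq0 orbb => /eqP.
(* The root is sought as a polynomial in [A]: it is then real and symmetric even though the
   diagonalisation is complex. [undup] makes the nodes distinct. *)
have [p hp] := poly_interpolation (fun x => Num.sqrt (Num.sqrt x))
  (undup_uniq [seq r 0 i | i : 'I_d.+1]).
have sC : horner_mx (symval A) p \in @symm_pred R d.+1.
  rewrite unfold_in /symm_pred; apply/eqP.
  elim/poly_ind: (p) => [|q c IH]; first by rewrite !rmorph0 trmx0.
  rewrite !rmorphD !rmorphM /= horner_mx_X horner_mx_C linearD /= tr_scalar_mx.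
  rewrite [_^T]trmx_mul IH symmxT; congr (_ + _).
  by apply: comm_mx_horner.
exists (SymMx sC) => /=.
rewrite -[_ *m _]/(_ * _) -[horner_mx _ _ *m _]/(_ * _) -!rmorphM /=.
apply: (map_mx_inj (f := real_complex R)).
rewrite map_horner_mx AE horner_mx_uconjC// horner_mx_diag.
congr (_ *m diag_mx _ *m _); apply/rowP => i; rewrite !mxE horner_map.
congr (real_complex R _); rewrite !hornerM hp; last first.
  by rewrite mem_undup; apply/mapP; exists i; rewrite // mem_enum.
by rewrite -!expr2 !sqr_sqrtr// ?sqrtr_ge0// ltW.
Qed.

Lemma posdef_unitmx (d : nat) (A : 'M[R]_d) :
  (forall x : 'rV_d, x != 0 -> 0 < (x *m A *m x^T) 0 0) -> A \in unitmx.
Proof.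
move=> pA; rewrite -row_free_unit; apply: inj_row_free => v vA.
apply/eqP/negPn/negP => /pA; rewrite vA mul0mx mxE ltxx //.
Qed.

Lemma sqrt_symP (d : nat) (S : symmx R d) : posdef S ->
  posdef (sqrt_sym S) /\ sqrt_sym S *m sqrt_sym S = S :> 'M[R]_d.
Proof.
move=> pS; apply: (@getPex _ (fun B : symmx R d =>
  posdef B /\ B *m B = S :> 'M[R]_d)).
have [C CE] := posdef_fourth_root pS.
have sB : (C *m C : 'M[R]_d) \in @symm_pred R d.
  by rewrite unfold_in /symm_pred trmx_mul symmxT.
exists (SymMx sB); split=> //= x x0.
have xC0 : x *m C != 0.
  apply: contra x0 => /eqP xC0; have := posdef_unitmx pS.
  by rewrite -CE !unitmx_mul andbb => /andP[Cu _];
     rewrite -(mulmxK Cu x) xC0 mul0mx.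
rewrite mulmxA -[_ *m C *m x^T]mulmxA -[X in _ *m (X *m _)]symmxT -trmx_mul.
move: (x *m C) xC0 => {x x0} y xC0; rewrite mxE lt_neqAle sumr_ge0 ?andbT => [|j _];
  last by rewrite mxE -expr2 sqr_ge0.
apply: contra xC0; rewrite eq_sym psumr_eq0 => [/allP y0|j _];
  last by rewrite mxE -expr2 sqr_ge0.
apply/eqP/rowP => j; have /y0 := mem_index_enum j.
by rewrite /= !mxE mulf_eq0 orbb => /eqP.
Qed.

End SquareRoot.

(** * Coordinates on symmetric matrices *)

Section VecsCoordinates.
Variables (R : realType) (d : nat) (idx : 'I_(qdim d) -> 'I_d * 'I_d).
Hypothesis hidx : sym_ordering idx.
Local Notation x a S := (tnth (vecs idx S) a).
Local Notation E := (symE R idx).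

Lemma vecs_wt_gt0 a : 0 < vecs_wt R idx a.
Proof. by rewrite /vecs_wt; case: ifP => _; rewrite ?ltr01// sqrtr_gt0. Qed.

Lemma symmx_ij (S : symmx R d) i j : S i j = S j i.
Proof. by rewrite -[in LHS](symmxT S) mxE. Qed.

Lemma symval_sum (I : Type) (r : seq I) (F : I -> symmx R d) :
  symval (\sum_(i <- r) F i) = \sum_(i <- r) symval (F i).
Proof. exact: (big_morph (@symval R d)). Qed.

Lemma symmxZ_ij c (S : symmx R d) i j : (c *: S) i j = c * S i j.
Proof. exact: mxE. Qed.

Lemma symE_ij a b : E a (idx b).1 (idx b).2 = (a == b)%:R / vecs_wt R idx a.
Proof.
have := vecs_symE R a b hidx; rewrite tnth_mktuple => h.
have w0 : vecs_wt R idx b != 0 by rewrite gt_eqF ?vecs_wt_gt0.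
apply: (mulfI w0); rewrite h eq_sym; case: eqVneq => [->|_].
  by rewrite mul1r mulfV.
by rewrite mul0r mulr0.
Qed.

Lemma vecs_expansion (S : symmx R d) : S = \sum_a x a S *: E a.
Proof.
have [inj rg] := hidx; apply: val_inj.
change (symval S = symval (\sum_a x a S *: E a)); apply/matrixP => i j.
wlog ij : i j / (i <= j)%N.
  by move=> h; have [/h//|/ltnW/h] := leqP i j; rewrite symmx_ij => ->; rewrite symmx_ij.
have [b _ bE] : range idx (i, j) by rewrite rg.
have -> : symval (\sum_a x a S *: E a) i j = \sum_a x a S * E a i j.
  by rewrite symval_sum summxE; apply: eq_bigr => a _; exact: symmxZ_ij.
rewrite (bigD1 b)// big1 => [|a ab].
  rewrite tnth_mktuple bE.
  have -> : E b i j = (b == b)%:R / vecs_wt R idx b by have := symE_ij b b; rewrite bE.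
  rewrite eqxx.
  have w0 : vecs_wt R idx b != 0 by rewrite gt_eqF ?vecs_wt_gt0.
  by rewrite mul1r mulrAC (mulfV w0) mul1r /= addr0.
have -> : E a i j = (a == b)%:R / vecs_wt R idx a by have := symE_ij a b; rewrite bE.
rewrite (negbTE ab).
by rewrite mul0r mulr0.
Qed.

Lemma vecsD a (S T : symmx R d) : x a (S + T) = x a S + x a T.
Proof. by rewrite !tnth_mktuple mxE mulrDr. Qed.

Lemma vecsZ a c (S : symmx R d) : x a (c *: S) = c * x a S.
Proof. by rewrite !tnth_mktuple mxE mulrCA. Qed.

Lemma vecs_sum a (I : Type) (r : seq I) (F : I -> symmx R d) :
  x a (\sum_(i <- r) F i) = \sum_(i <- r) x a (F i).
Proof.
apply: (big_morph (fun S => x a S) (vecsD a)).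
by rewrite tnth_mktuple mxE mulr0.
Qed.

Lemma vecs_combination (y : 'I_(qdim d) -> R) b : x b (\sum_a y a *: E a) = y b.
Proof.
rewrite vecs_sum (bigD1 b)//= big1 => [|a ab]; rewrite vecsZ vecs_symE//.
  by rewrite eqxx mulr1 addr0.
by rewrite eq_sym (negbTE ab) mulr0.
Qed.

(** Off the diagonal, two equal entries 1/sqrt 2 of [E a] contribute 2/sqrt 2 = sqrt 2, which is the
    weight in [vecs]. The coordinates are thus taken in an orthonormal basis. *)
Lemma frob_symE a (S : symmx R d) : frob_dot (E a) S = x a S.
Proof.
rewrite tnth_mktuple /frob_dot symmxT /mxtrace.
set w := vecs_wt R idx a; have w0 : w != 0 by rewrite gt_eqF ?vecs_wt_gt0.
transitivity (\sum_i \sum_j E a i j * S i j).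
  by apply: eq_bigr => k _; rewrite mxE; apply: eq_bigr => l _; rewrite [S l k]symmx_ij.
rewrite pair_big /=; have [e|ne] := eqVneq (idx a).1 (idx a).2.
  have swap (p : 'I_d * 'I_d) : (p.2, p.1) == idx a = (p == idx a).
    case: p => k l; rewrite [idx a]surjective_pairing !xpair_eqE /= -!e.
    by rewrite andbC.
  rewrite (bigD1 (idx a))//= big1 => [|[k l] kl].
    rewrite mxE -surjective_pairing eqxx /= addr0 /vecs_wt e eqxx.
    by rewrite invr1 /w /vecs_wt e eqxx.
  by rewrite mxE /= (swap (k, l)) orbb (negbTE kl) mul0r.
have sw : ((idx a).2, (idx a).1) != idx a.
  by rewrite [X in _ != X]surjective_pairing xpair_eqE negb_and eq_sym ne.
rewrite (bigD1 (idx a))//= (bigD1 ((idx a).2, (idx a).1))//= big1 ?addr0.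
  rewrite !mxE -surjective_pairing eqxx orbT /= [S (idx a).2 _]symmx_ij -mulrDr.
  rewrite -mulr2n -mulr_natl mulrA; congr (_ * _).
  rewrite /w /vecs_wt (negbTE ne).
  by rewrite mulrC -{1}(sqr_sqrtr (ler0n R 2)) expr2 mulfK// gt_eqF ?sqrtr_gt0.
move=> [k l] /andP[kl kl']; rewrite mxE (negbTE kl) /=.
case: eqP => [h|_]; last by rewrite mul0r.
by move: kl'; rewrite -h /= eqxx.
Qed.

End VecsCoordinates.

(** * The covariance matrix as a Gram matrix *)

Section OmegaAlgebra.
Variables (R : realType) (d : nat) (idx : 'I_(qdim d) -> 'I_d * 'I_d).
Hypothesis hidx : sym_ordering idx.
Variables Psi Sigma : symmx R d.
Hypotheses (hPsi : posdef Psi) (hSigma : posdef Sigma).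
Local Notation x a S := (tnth (vecs idx S) a).
Local Notation E := (symE R idx).
Local Notation P := (symval (sqrt_sym Psi)).
Local Notation Q := (symval (sqrt_sym Sigma)).
Local Notation Om := (Omega idx Psi Sigma).

(** For symmetric A and B, transposition gives tr(Psi A Sigma B) = tr(Sigma A Psi B), so the two
    halves of [covK] contribute equally. As a Gram matrix, [Om] is visibly symmetric and
    nonnegative. *)
Lemma Omega_frob a b :
  Om a b = frob_dot (P *m E a *m Q) (P *m E b *m Q).
Proof.
have [_ PP] := sqrt_symP hPsi; have [_ QQ] := sqrt_symP hSigma.
have -> : frob_dot (P *m E a *m Q) (P *m E b *m Q) =
    \tr (Sigma *m E a *m Psi *m E b).
  rewrite /frob_dot !trmx_mul !symmxT -PP -QQ !mulmxA mxtrace_mulC !mulmxA //.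
rewrite mxE; move: (symval (E a)) (symval (E b)) (symmxT (E a)) (symmxT (E b)).
move=> A B AT BT.
have h : \tr (Psi *m A *m Sigma *m B) = \tr (Sigma *m A *m Psi *m B).
  by rewrite -mxtrace_tr !trmx_mul !symmxT AT BT mxtrace_mulC !mulmxA.
rewrite /frob_dot /covK linearZ /= linearD /= !trmx_mul !symmxT AT.
rewrite -scalemxAl mulmxDl mxtraceZ mxtraceD !mulmxA h.
by field.
Qed.

(** The coordinate is the Frobenius product with [E a]; the two summands of [Vdir] are transposes of
    each other and give the same trace, whence the factor 2. *)
Lemma vecs_Vdir a i j :
  x a (Vdir Psi Sigma i j) = 2 * (P *m E a *m Q) i j.
Proof.
have key (A : 'M[R]_d) : \tr (A *m delta_mx j i) = A i j.
  rewrite /mxtrace (bigD1 i)//= big1 => [|k ki].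
    rewrite addr0 mxE (bigD1 j)//= big1 => [|l lj]; rewrite !mxE ?eqxx ?mulr1 ?addr0//.
    by rewrite (negbTE lj) mulr0.
  by rewrite mxE big1// => l _; rewrite mxE (negbTE ki) andbF mulr0.
have <- : \tr ((P *m E a *m Q) *m delta_mx j i) = (P *m E a *m Q) i j by [].
rewrite -frob_symE /frob_dot symmxT /= mulmxDr mxtraceD !mulmxA.
have h : \tr (E a *m P *m delta_mx i j *m Q) = \tr (E a *m Q *m delta_mx j i *m P).
  rewrite -mxtrace_tr !trmx_mul !symmxT trmx_delta !mulmxA.
  by rewrite mxtrace_mulC !mulmxA.
rewrite h (mxtrace_mulC _ P) !mulmxA; set t := \tr _; by ring.
Qed.

(** Links the directions V_ij of the operator to the covariance of the law: 1/4 cancels the two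
    factors 2 of [vecs_Vdir], and what is left is the Frobenius product of [Omega_frob]. *)
Lemma Vdir_Omega a b :
  4^-1 * \sum_i \sum_j x a (Vdir Psi Sigma i j) * x b (Vdir Psi Sigma i j) = Om a b.
Proof.
rewrite Omega_frob /frob_dot /mxtrace.
under [in RHS]eq_bigr do rewrite mxE.
rewrite exchange_big /= mulr_sumr; apply: eq_bigr => j _.
rewrite mulr_sumr; apply: eq_bigr => i _.
rewrite !vecs_Vdir [X in _ = X * _]mxE.
by move: ((P *m E a *m Q) i j) ((P *m E b *m Q) i j) => u v; field.
Qed.

Lemma Omega_sym : Om^T = Om.
Proof. by apply/matrixP => a b; rewrite mxE !Omega_frob frob_dotC. Qed.

(** The form at v is the squared norm of P W Q with W = sum_a v_a E_a. It vanishes only for W = 0,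
    as P and Q are invertible, and then v = 0 by reading off coordinates. *)
Lemma Omega_posdef (v : 'rV_(qdim d)) : v != 0 -> 0 < (v *m Om *m v^T) 0 0.
Proof.
move=> v0; have [pP _] := sqrt_symP hPsi; have [pQ _] := sqrt_symP hSigma.
pose W := \sum_a v 0 a *: symval (E a).
have -> : (v *m Om *m v^T) 0 0 = frob_dot (P *m W *m Q) (P *m W *m Q).
  have WE : P *m W *m Q = \sum_a v 0 a *: (P *m E a *m Q).
    rewrite mulmx_sumr mulmx_suml; apply: eq_bigr => a _.
    by rewrite -scalemxAr -scalemxAl.
  have dot_suml (B : 'M[R]_d) : frob_dot (P *m W *m Q) B =
      \sum_a v 0 a * frob_dot (P *m E a *m Q) B.
    rewrite WE /frob_dot linear_sum /= mulmx_suml raddf_sum.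
    by apply: eq_bigr => a _; rewrite linearZ /= -scalemxAl mxtraceZ.
  rewrite dot_suml mxE [RHS](eq_bigr (fun a => v 0 a * \sum_b Om a b * v 0 b)).
    under [RHS]eq_bigr do rewrite mulr_sumr.
    rewrite exchange_big; apply: eq_bigr => b _ /=; rewrite !mxE mulr_suml.
    by apply: eq_bigr => a _; rewrite mulrA.
  move=> a _; rewrite frob_dotC dot_suml; congr (_ * _); apply: eq_bigr => b _.
  by rewrite Omega_frob frob_dotC mulrC.
rewrite lt_neqAle frob_dot_ge0 andbT eq_sym; apply: contra v0 => /eqP/frob_dot_eq0 PWQ0.
have W0 : W = 0.
  by rewrite -(mulKmx (posdef_unitmx pP) W) -(mulmxK (posdef_unitmx pQ) (P *m W))
             PWQ0 mul0mx mulmx0.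
have : \sum_a v 0 a *: E a = 0.
  apply: val_inj; rewrite [LHS](symval_sum _ (fun a => v 0 a *: E a)) -[RHS]W0.
  by apply: eq_bigr => a _; exact/matrixP.
move=> S0; apply/eqP/rowP => b; rewrite mxE.
have := congr1 (fun S => x b S) S0; rewrite vecs_combination// => ->.
by rewrite tnth_mktuple mxE mulr0.
Qed.

End OmegaAlgebra.

(** * Positive definite quadratic forms *)

Section PosdefForm.
Variables (R : realType) (n : nat) (Om : 'M[R]_n).
Hypothesis Om_sym : Om^T = Om.
Hypothesis Om_posdef : forall v : 'rV_n, v != 0 -> 0 < (v *m Om *m v^T) 0 0.

Lemma posdef_form_ge0 (v : 'rV_n) : 0 <= (v *m Om *m v^T) 0 0.
Proof.
have [->|/Om_posdef/ltW//] := eqVneq v 0.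
by rewrite mul0mx mul0mx mxE.
Qed.

Lemma posdef_diag_gt0 a : 0 < Om a a.
Proof.
have : delta_mx 0 a != 0 :> 'rV[R]_n.
  by apply/eqP => /rowP/(_ a)/eqP; rewrite !mxE !eqxx oner_eq0.
move/Om_posdef; rewrite trmx_delta -rowE mxE.
rewrite (bigD1 a)//= big1 => [|b ba]; rewrite !mxE ?eqxx ?mulr1 ?addr0//.
by rewrite (negbTE ba) mulr0.
Qed.

Lemma inv_form_ge0 (z : 'rV_n) : 0 <= (z *m invmx Om *m z^T) 0 0.
Proof.
have Omu := posdef_unitmx Om_posdef.
have := posdef_form_ge0 (z *m invmx Om).
by rewrite mulmxKV// trmx_mul trmx_inv Om_sym mulmxA.
Qed.

(* Cauchy-Schwarz for the form Om, applied to z Om^-1 and the a-th basis vector. *)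
Lemma inv_form_coercive (z : 'rV_n) a :
  z 0 a ^+ 2 <= Om a a * (z *m invmx Om *m z^T) 0 0.
Proof.
have Omu := posdef_unitmx Om_posdef.
have [u [uE zE]] : exists u, z *m invmx Om = u /\ z = u *m Om.
  by exists (z *m invmx Om); rewrite mulmxKV.
pose e : 'rV[R]_n := delta_mx 0 a.
have ge s : 0 <= (u *m z^T) 0 0 - 2 * s * z 0 a + s ^+ 2 * Om a a.
  have := posdef_form_ge0 (u - s *: e).
  rewrite mulmxBl -zE linearB /= linearZ /= mulmxBl !mulmxBr.
  rewrite -!scalemxAl -!scalemxAr.
  have uz : z *m u^T = u *m z^T.
    by rewrite zE trmx_mul Om_sym mulmxA.
  have ze : (z *m e^T) 0 0 = z 0 a.
    rewrite trmx_delta mxE (bigD1 a)//= big1 => [|b ba]; rewrite !mxE ?eqxx ?mulr1 ?addr0//.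
    by rewrite (negbTE ba) mulr0.
  have ez : (e *m Om *m u^T) 0 0 = z 0 a.
    have -> : e *m Om *m u^T = (z *m e^T)^T.
      by rewrite zE !trmx_mul trmxK Om_sym mulmxA.
    by rewrite mxE.
  have ee : (e *m Om *m e^T) 0 0 = Om a a.
    rewrite -rowE trmx_delta mxE (bigD1 a)//= big1 => [|b ba];
      rewrite !mxE ?eqxx ?mulr1 ?addr0//.
    by rewrite (negbTE ba) mulr0.
  rewrite uz => h; apply: le_trans h _; rewrite !mxE in ze ez ee *.
  by rewrite ze ez ee; lra.
have Oa := posdef_diag_gt0 a; rewrite uE; set q := (u *m z^T) 0 0 in ge *.
have zt : z 0 a = z 0 a / Om a a * Om a a by rewrite divfK// gt_eqF.
(* The minimiser in s of the quadratic polynomial in [ge]. *)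
have := ge (z 0 a / Om a a); move: zt; set t := z 0 a / Om a a => -> h.
rewrite (_ : _ ^+ 2 = Om a a * (t ^+ 2 * Om a a)); last by ring.
by rewrite ler_wpM2l ?(ltW Oa)//; lra.
Qed.

End PosdefForm.

(** * Measurability of continuous functions of the coordinates *)

Section TupleMeasurability.
Variables (R : realType) (n : nat).
Local Notation tupR := (n.-tuple (measurableTypeR R)).

(** There are countably many integer vectors, so the preimage is a countable union of boxes for an
    arbitrary [D]. Hence every function of the rounded coordinates is measurable. *)
Lemma measurable_tuple_floor (k : R) (D : set {ffun 'I_n -> int}) :
  measurable ((fun y : tupR => [ffun i => Num.floor (k * tnth y i)]) @^-1` D).
Proof.
pose N (v : {ffun 'I_n -> int}) := [set y : tupR | D v /\ forall i,
  Num.floor (k * tnth y i) = v i].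
rewrite (_ : _ @^-1` _ = \bigcup_v N v); last first.
  apply/seteqP; split => [y Dy|y [v _ [Dv Nv]]] /=.
    by exists [ffun i => Num.floor (k * tnth y i)] => //; split=> // i; rewrite ffunE.
  by rewrite (_ : [ffun _ => _] = v)//; apply/ffunP => i; rewrite ffunE.
apply: countable_bigcupT_measurable; first exact: countableP.
move=> v; have [Dv|Dv] := pselect (D v); last first.
  by rewrite (_ : N v = set0)//; apply/seteqP; split => // y [].
rewrite (_ : N v = \bigcap_(i in [set: 'I_n])
    ((fun y : tupR => k * tnth y i) @^-1` [set` `[(v i)%:~R, (v i + 1)%:~R[])).
  apply: fin_bigcap_measurable => // i _; rewrite -[X in measurable X]setTI.
  by apply: measurable_funM => //; exact: measurable_tnth.
apply/seteqP; split => [y [_ Ny] i _|y Ny] /=.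
  by rewrite in_itv /= -Ny floor_le floorD1_gt.
split=> // i; have := Ny i Logic.I; rewrite /= in_itv /=.
exact: floor_def.
Qed.

Lemma floor_div_cvg (x : R) :
  (Num.floor (k.+1%:R * x))%:~R / k.+1%:R @[k --> \oo] --> x.
Proof.
apply/cvgrPdist_le => /= e e0; near=> k.
have k0 : 0 < k.+1%:R :> R by [].
rewrite -(ler_pM2l k0) -{1}(gtr0_norm k0) -normrM mulrBr mulrCA mulfV ?gt_eqF// mulr1.
rewrite ger0_norm ?subr_ge0 ?floor_le// lerBlDl.
apply: (@le_trans _ _ ((Num.floor (k.+1%:R * x))%:~R + 1)).
  by have := floorD1_gt (k.+1%:R * x); rewrite intrD => /ltW.
rewrite lerD2l -ler_pdivrMr// mul1r.
near: k; apply: filterS (near_infty_natSinv_lt (PosNum e0)) => k /= /ltW ke.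
by rewrite -(invrK (k.+1%:R)) lef_pV2// posrE ?invr_gt0.
Unshelve. all: by end_near. Qed.

(* Approximates f by its values on the grids (1/k) Z^n. *)
Lemma measurable_comp_lincomb (V : normedModType R) (e : 'I_n -> V) (f : V -> R) :
  continuous f ->
  measurable_fun setT (fun y : tupR => f (\sum_i tnth y i *: e i)).
Proof.
move=> cf.
pose h k (y : tupR) := f (\sum_i ((Num.floor (k.+1%:R * tnth y i))%:~R / k.+1%:R) *: e i).
apply: (@measurable_fun_cvg _ _ _ _ h) => [k _ B mB|y _].
  rewrite setTI; have := measurable_tuple_floor k.+1%:R
    [set v | B (f (\sum_i ((v i)%:~R / k.+1%:R) *: e i))].
  congr measurable; apply/funext => y /=; rewrite /h.
  by under eq_bigr do rewrite ffunE.
apply: continuous_cvg; first exact: cf.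
apply: cvg_big => [|i _]; first exact: add_continuous.
by apply: cvgZr_tmp; exact: floor_div_cvg.
Qed.

End TupleMeasurability.

(** * Directional derivatives and integration over R^n *)

Lemma is_derive_line (R : realType) (V : normedModType R) (f : V -> R) (S v : V) (df : R) :
  is_derive S v f df <-> is_derive (0 : R) (1 : R) (fun s => f (S + s *: v)) df.
Proof.
have E : (fun h : R => h^-1 *: (((fun s => f (S + s *: v)) \o shift 0) (h *: 1) -
      f (S + 0 *: v))) =
    (fun h => h^-1 *: ((f \o shift S) (h *: v) - f S)).
  by apply/funext => h; rewrite /= scale0r !addr0 [h *: 1]mulr1 [S + _]addrC.
split=> -[df1 df2]; split; move: df1 df2; rewrite /derivable /derive E//.
Qed.

Section TupleIntegral.
Variable R : realType.
Local Notation mR := (measurableTypeR R).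
Local Notation leb := (@lebesgue_measure R).

Lemma tnth_tcons0 n (p : mR * n.-tuple mR) : tnth (tcons p) ord0 = p.1.
Proof. by []. Qed.

Lemma tnth_tconsS n (p : mR * n.-tuple mR) i : tnth (tcons p) (lift ord0 i) = tnth p.2 i.
Proof. by rewrite !(tnth_nth 0). Qed.

Definition tbox n (K : R) : set (n.-tuple mR) := [set y | forall i, `|tnth y i| <= K].

Lemma measurable_tbox n K : measurable (@tbox n K).
Proof.
rewrite (_ : tbox K = \bigcap_(i in [set: 'I_n])
    ((fun y : n.-tuple mR => tnth y i) @^-1` [set` `[-K, K]])).
  apply: fin_bigcap_measurable => // i _; rewrite -[X in measurable X]setTI.
  by apply: measurable_tnth.
apply/seteqP; split => [y Ny i _|y Ny i] /=.
  by rewrite in_itv /= -ler_norml.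
by have := Ny i Logic.I; rewrite /= in_itv /= -ler_norml.
Qed.

Lemma tuple_lebesgue_tbox n K : (tuple_lebesgue R n (@tbox n K) < +oo)%E.
Proof.
elim: n => [|n IH] /=.
  by rewrite /dirac /= indicE; case: (_ \in _); rewrite ltry.
rewrite /cons_measure /pushforward.
rewrite (_ : _ @^-1` _ = [set` `[-K, K]] `*` @tbox n K).
  rewrite product_measure1E//; last exact: measurable_tbox.
  apply: lte_mul_pinfty => //.
  suff : lebesgue_measure [set` `[- K, K]%R] \is a fin_num by [].
  by rewrite lebesgue_measure_itv /=; case: ifP.
apply/seteqP; split => [[x t] /= h|[x t] [/= xK tK] i].
  split; first by rewrite /= in_itv /= -ler_norml; exact: (h ord0).
  by move=> i; have := h (lift ord0 i); rewrite tnth_tconsS.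
case: (unliftP ord0 i) => [j ->|->]; first by rewrite tnth_tconsS.
by rewrite tnth_tcons0 ler_norml; move: xK; rewrite in_itv.
Qed.

Lemma integral_tcons n (f : n.+1.-tuple mR -> R) :
  (tuple_lebesgue R n.+1).-integrable setT (EFin \o f) ->
  (leb \x tuple_lebesgue R n)%E.-integrable setT (EFin \o (f \o @tcons R n)) /\
  (\int[tuple_lebesgue R n.+1]_y (f y)%:E =
   \int[(leb \x tuple_lebesgue R n)%E]_p (f (tcons p))%:E)%E.
Proof.
move=> If; have mf := measurable_int _ If.
have mt := @measurable_tcons R n.
have I2 : (leb \x tuple_lebesgue R n)%E.-integrable setT (EFin \o (f \o @tcons R n)).
  apply/integrableP; split; first exact: (measurableT_comp mf mt).
  have /integrableP[_] := If; apply: le_lt_trans.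
  rewrite /= ge0_integral_pushforward//=.
  by do 2 apply: measurableT_comp => //; exact/measurable_EFinP.
split => //.
by rewrite /= integral_pushforward.
Qed.

Definition tshift n (y : n.-tuple mR) (a : 'I_n) (s : R) : n.-tuple mR :=
  [tuple tnth y i + (if i == a then s else 0) | i < n].

Lemma tshift_tcons0 n (x : R) (t : n.-tuple mR) s :
  tshift (tcons (x, t)) ord0 s = tcons (x + s : mR, t).
Proof.
apply: eq_from_tnth => i; rewrite tnth_mktuple.
case: (unliftP ord0 i) => [j ->|->]; last by rewrite !tnth_tcons0.
by rewrite !tnth_tconsS addr0.
Qed.

Lemma tshift_tconsS n (x : R) (t : n.-tuple mR) a s :
  tshift (tcons (x, t)) (lift ord0 a) s = tcons (x : mR, tshift t a s).
Proof.
apply: eq_from_tnth => i; rewrite tnth_mktuple.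
case: (unliftP ord0 i) => [j ->|->]; last by rewrite !tnth_tcons0 addr0.
by rewrite !tnth_tconsS tnth_mktuple (inj_eq lift_inj).
Qed.

Lemma integrable_tbox_supported n (g : n.-tuple mR -> R) (K B : R) :
  measurable_fun setT g -> (forall y, `|g y| <= B) ->
  (forall y i, K < `|tnth y i| -> g y = 0) ->
  (tuple_lebesgue R n).-integrable setT (EFin \o g).
Proof.
move=> mg gB gK; have mK := @measurable_tbox n K.
apply: (@le_integrable _ _ _ _ _ measurableT _ (EFin \o (cst B \* \1_(tbox K)))).
- exact/measurable_EFinP.
- move=> y _ /=; rewrite lee_fin indicE.
  have [yK|] := boolP (y \in tbox K); first by rewrite mulr1 (le_trans (gB y)) ?ler_norm.
  rewrite mulr0 normr0 => /negP yK.
  have /existsNP[i /negP] : ~ (tbox K y) by move=> h; apply: yK; rewrite inE.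
  by rewrite -ltNge => /gK ->; rewrite normr0.
- apply: (@integrableZl _ _ _ _ _ measurableT B (EFin \o \1_(tbox K))).
  apply/integrableP; split; first exact/measurable_EFinP.
  rewrite (eq_integral (fun y => (\1_(tbox K) y)%:E)) => [|y _]; last first.
    by rewrite /= ger0_norm.
  by rewrite integral_indic// setIT tuple_lebesgue_tbox.
Qed.

Lemma integral_derive_eq0 (F f : R -> R) (K : R) :
  (forall x : R, is_derive x (1 : R) F (f x)) -> continuous f ->
  (forall x, K < `|x| -> F x = 0 /\ f x = 0) ->
  (\int[leb]_x (f x)%:E = 0)%E.
Proof.
(* The support condition concerns K < |x| only and K may be negative; this choice puts both
   endpoints -L and L where [F] vanishes. *)
move=> dF cf FK; pose L : R := `|K| + 1.
have L0 : 0 < L by rewrite ltr_wpDl.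
have KL (x : R) : L <= `|x| -> K < `|x|.
  by apply: lt_le_trans; rewrite (le_lt_trans (ler_norm _))// ltrDl.
have mf : measurable_fun setT f by exact: continuous_measurable_fun.
have -> : (\int[leb]_x (f x)%:E = \int[leb]_(x in `[(-L)%R, L]) (f x)%:E)%E.
  rewrite [RHS]integral_mkcond; apply: eq_integral => x _; rewrite patchE.
  case: ifPn => //; rewrite notin_setE /= in_itv /= -ler_norml => /negP.
  by rewrite -ltNge => /ltW/KL/FK[_ ->].
have cF : continuous F.
  by move=> x; apply/differentiable_continuous/derivable1_diffP; exact: ex_derive.
rewrite (@continuous_FTC2 _ f F).
- have [-> _] := FK L (KL _ (ler_norm L)).
  by have [|-> _] := FK (- L); [rewrite KL// normrN ler_norm|rewrite subee].
- by rewrite gtrN.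
- exact: continuous_subspaceT.
- by split => [x _||]; [exact: ex_derive|apply: cvg_at_right_filter|
    apply: cvg_at_left_filter]; exact: cF.
- by move=> x _; rewrite derive1E; exact: derive_val.
Qed.

(** [g'] is bounded and vanishes outside a box, hence is integrable, and Fubini allows the direction
    [a] to be integrated early. If [a] is the first coordinate, the inner integral over it vanishes
    by [integral_derive_eq0]; otherwise the inner integral over the remaining coordinates vanishes
    by induction. *)
Lemma integral_tuple_derive_eq0 n (a : 'I_n) (g g' : n.-tuple mR -> R) (K B : R) :
  measurable_fun setT g' -> (forall y, `|g' y| <= B) ->
  (forall y i, K < `|tnth y i| -> g y = 0 /\ g' y = 0) ->
  (forall y, is_derive (0 : R) (1 : R) (fun s => g (tshift y a s)) (g' y)) ->
  (forall y, continuous (fun s => g' (tshift y a s))) ->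
  (\int[tuple_lebesgue R n]_y (g' y)%:E = 0)%E.
Proof.
elim: n a g g' => [[]//|n IH] a g g' mg' gB gK dg cg'.
have Ig' : (tuple_lebesgue R n.+1).-integrable setT (EFin \o g').
  by apply: (integrable_tbox_supported mg' gB) => y i /gK[].
have [I2 ->] := integral_tcons Ig'.
case: (unliftP ord0 a) => [b ab|a0].
  rewrite -(integral12_prod_meas1 I2) /=; apply: integral0_eq => x _.
  apply: (IH b (fun t => g (tcons (x, t))) (fun t => g' (tcons (x, t)))).
  - apply: measurableT_comp mg' _; apply: measurableT_comp; first exact: measurable_tcons.
    exact: measurable_fun_pair.
  - by move=> t; exact: gB.
  - by move=> t i; rewrite -[tnth t i](tnth_tconsS (x, t)) => /gK.
  - move=> t; have := dg (tcons (x, t)); rewrite ab.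
    by under eq_fun do rewrite tshift_tconsS.
  - move=> t; have := cg' (tcons (x, t)); rewrite ab.
    by under eq_fun do rewrite tshift_tconsS.
rewrite -(integral21_prod_meas1 I2) /=; apply: integral0_eq => t _.
have shiftE x s : tshift (tcons (x, t)) a s = tcons (x + s : mR, t).
  by rewrite a0 tshift_tcons0.
apply: (@integral_derive_eq0 (fun x => g (tcons (x, t))) (fun x => g' (tcons (x, t))) K).
- move=> x; have := dg (tcons (x, t)); under eq_fun do rewrite shiftE.
  move=> h; apply/is_derive_line.
  rewrite (_ : (fun _ => _) = (fun s => g (tcons (x + s : mR, t))))//.
  by apply/funext => s; rewrite [s *: _]mulr1.
- have := cg' (tcons (0 : mR, t)); under eq_fun do rewrite shiftE.
  by under eq_fun do rewrite add0r.
- by move=> x; rewrite -[x in `|x|](tnth_tcons0 (x, t)) => /gK.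
Qed.

End TupleIntegral.

(** * Integration against a density and expectations under the normal law *)

Section DensityIntegral.
Context d (T : measurableType d) (R : realType).
Variables (mu nu : {measure set T -> \bar R}) (w : T -> R).
Hypothesis w_ge0 : forall x, 0 <= w x.
Hypothesis mw : measurable_fun setT w.
Hypothesis nuE : forall A, measurable A -> nu A = (\int[mu]_(x in A) (w x)%:E)%E.
Local Open Scope ereal_scope.
Import HBNNSimple.

Let mEw : measurable_fun setT (EFin \o w). Proof. exact/measurable_EFinP. Qed.

Let integral_density_nnsfun (h : {nnsfun T >-> R}) :
  \int[nu]_x (h x)%:E = \int[mu]_x ((h x)%:E * (w x)%:E).
Proof.
have mh r : measurable_fun setT (fun x => (r * \1_(h @^-1` [set r]) x)%:E).
  by apply/measurable_EFinP; exact: measurable_funM.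
transitivity (\int[nu]_x (\sum_(y \in range h) (y * \1_(h @^-1` [set y]) x)%:E)).
  by apply: eq_integral => t _; rewrite /= fimfunE -fsumEFin.
rewrite ge0_integral_fsum//; last by move=> m y _; exact: nnfun_muleindic_ge0.
transitivity (\int[mu]_x (\sum_(y \in range h)
    (y * \1_(h @^-1` [set y]) x)%:E * (w x)%:E)); last first.
  apply: eq_integral => x _.
  rewrite -ge0_mule_fsuml => [|y]; last exact: nnfun_muleindic_ge0.
  by rewrite fsumEFin // -(fimfunE _ x).
rewrite ge0_integral_fsum//; last 2 first.
  - by move=> y; apply: emeasurable_funM.
  - move=> m y _; apply: mule_ge0; last by rewrite lee_fin.
    exact: nnfun_muleindic_ge0.
apply: eq_fsbigr => r /[!inE] -[z _ rE].
have r0 : (0 <= r)%R by rewrite -rE.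
under eq_integral do rewrite EFinM.
rewrite ge0_integralZl ?lee_fin//; last exact/measurable_EFinP.
under [RHS]eq_integral do rewrite EFinM -muleA.
have mI : measurable (h @^-1` [set r]) by exact: measurable_sfunP.
rewrite [RHS]ge0_integralZl ?lee_fin//; last 2 first.
  - by apply: emeasurable_funM => //; exact/measurable_EFinP.
  - by move=> x _; rewrite mule_ge0 ?lee_fin.
congr (_ * _); rewrite integral_indic// setIT nuE//.
rewrite integral_mkcond; apply: eq_integral => x _.
by rewrite patchE indicE; case: ifPn => /=; rewrite ?mul1e ?mul0e.
Qed.

Lemma ge0_integral_density (f : T -> \bar R) :
  measurable_fun setT f -> (forall x, 0 <= f x) ->
  \int[nu]_x f x = \int[mu]_x (f x * (w x)%:E).
Proof.
move=> mf f0; pose h := nnsfun_approx measurableT mf.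
have fE x : f x = lim ((EFin \o h n) x @[n --> \oo]).
  by apply/esym/cvg_lim => //; exact: cvg_nnsfun_approx.
have fwE x : f x * (w x)%:E = lim ((EFin \o h n) x * (w x)%:E @[n --> \oo]).
  by apply/esym/cvg_lim => //; apply: cvgeZr => //; exact: cvg_nnsfun_approx.
under eq_integral do rewrite fE.
under [RHS]eq_integral do rewrite fwE.
rewrite monotone_convergence//; last 3 first.
- by move=> n; exact/measurable_EFinP.
- by move=> n x _; rewrite lee_fin.
- by move=> x _ a b ab; rewrite lee_fin; exact/lefP/nd_nnsfun_approx.
rewrite [RHS]monotone_convergence//.
- by congr (lim (_ @ \oo)); apply/funext => n; exact: integral_density_nnsfun.
- by move=> n; apply: emeasurable_funM => //; exact/measurable_EFinP.
- by move=> n x _; rewrite mule_ge0 ?lee_fin.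
- move=> x _ a b ab; rewrite lee_wpmul2r ?lee_fin//; exact/lefP/nd_nnsfun_approx.
Qed.

End DensityIntegral.

Section MvnLaw.
Variables (R : realType) (n : nat) (mu : n.-tuple (measurableTypeR R)) (Om : 'M[R]_n).
Local Notation tupR := (n.-tuple (measurableTypeR R)).
Local Notation w := (mvn_pdf mu Om).

Lemma mvn_pdf_ge0 y : 0 <= w y.
Proof. by rewrite mulr_ge0 ?expR_ge0// invr_ge0 sqrtr_ge0. Qed.

Lemma measurable_mvn_pdf : measurable_fun setT w.
Proof.
apply: measurable_funM => //; apply: measurableT_comp => //.
apply: measurable_funM => //; apply: measurableT_comp => //.
have mz i : measurable_fun setT (fun y : tupR => tnth y i - tnth mu i).
  by apply: measurable_funB => //; exact: measurable_tnth.
rewrite (_ : (fun _ => _) = (fun y => \sum_j (\sum_i (tnth y i - tnth mu i) * invmx Om i j)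
    * (tnth y j - tnth mu j))).
  apply: measurable_sum => j; apply: measurable_funM => //.
  by apply: measurable_sum => i; exact: measurable_funM.
apply/funext => y; rewrite mxE; apply: eq_bigr => j _; rewrite !mxE.
by congr (_ * _); apply: eq_bigr => i _; rewrite mxE.
Qed.

Context (dT : measure_display) (T : measurableType dT) (P : probability T R).
Variable Y : T -> tupR.
Hypothesis mY : measurable_fun setT Y.
Hypothesis hY : has_law_mvn P Y mu Om.

Lemma ge0_expectation_mvn (h : tupR -> \bar R) :
  measurable_fun setT h -> (forall y, 0 <= h y)%E ->
  (\int[P]_t h (Y t) = \int[tuple_lebesgue R n]_y (h y * (w y)%:E))%E.
Proof.
move=> mh h0.
rewrite -(@ge0_integral_density _ _ _ (tuple_lebesgue R n) (pushforward P Y))//.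
- by rewrite ge0_integral_pushforward.
- exact: mvn_pdf_ge0.
- exact: measurable_mvn_pdf.
Qed.

(** Expresses integrability by the density alone, so that it can be carried from one random variable
    to another with the same law. *)
Lemma integrable_mvnP (h : tupR -> R) : measurable_fun setT h ->
  P.-integrable setT (EFin \o (h \o Y)) <->
  (tuple_lebesgue R n).-integrable setT (fun y => (h y * w y)%:E).
Proof.
move=> mh; have E : (\int[P]_t `|(h (Y t))%:E| =
    \int[tuple_lebesgue R n]_y `|(h y * w y)%:E|)%E.
  rewrite (ge0_expectation_mvn (h := fun y => `|(h y)%:E|%E))//.
    by apply: eq_integral => y _; rewrite /= normrM (ger0_norm (mvn_pdf_ge0 y)) EFinM.
  by apply: measurableT_comp => //; exact/measurable_EFinP.
have mhw : measurable_fun setT (fun y => h y * w y).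
  by apply: measurable_funM => //; exact: measurable_mvn_pdf.
split=> /integrableP[_ h1]; apply/integrableP; split; rewrite ?E// -?E//.
- exact/measurable_EFinP.
- exact/measurable_EFinP/measurableT_comp.
Qed.

Lemma expectation_mvn (h : tupR -> R) : measurable_fun setT h ->
  (\int[P]_t (h (Y t))%:E = \int[tuple_lebesgue R n]_y (h y * w y)%:E)%E.
Proof.
(* Since [w] is nonnegative, multiplication by it commutes with taking positive and negative
   parts. *)
move=> mh; rewrite integralE [RHS]integralE.
have mEh : measurable_fun setT (EFin \o h) by exact/measurable_EFinP.
congr (_ - _)%E.
- under eq_integral do rewrite (funepos_comp (EFin \o h) Y).
  rewrite ge0_expectation_mvn//; last exact: measurable_funepos.
  apply: eq_integral => y _; rewrite !funeposE /=.
  by rewrite -EFin_max -EFin_max -EFinM maxr_pMl ?mvn_pdf_ge0// mul0r.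
- under eq_integral do rewrite (funeneg_comp (EFin \o h) Y).
  rewrite ge0_expectation_mvn//; last exact: measurable_funeneg.
  apply: eq_integral => y _; rewrite !funenegE /=.
  by rewrite -EFin_max -EFin_max -EFinM maxr_pMl ?mvn_pdf_ge0// mul0r mulNr.
Qed.

End MvnLaw.

Lemma dominated_cvg_integral d (T : measurableType d) (R : realType)
    (mu : {measure set T -> \bar R}) (f_ : nat -> T -> R) (f g : T -> R) :
  (forall k, measurable_fun setT (f_ k)) ->
  (forall x, f_ k x @[k --> \oo] --> f x) ->
  (forall k x, `|f_ k x| <= g x) ->
  mu.-integrable setT (EFin \o g) ->
  mu.-integrable setT (EFin \o f) /\
  (\int[mu]_x (f_ k x)%:E @[k --> \oo] --> \int[mu]_x (f x)%:E)%E.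
Proof.
move=> mf_ f_f f_g ig.
have [||||If _ cvgf] := @dominated_convergence _ _ _ mu setT measurableT
  (fun k => EFin \o f_ k) (EFin \o f) (EFin \o g) _ _ _ ig _.
- by move=> k; exact/measurable_EFinP.
- by apply/measurable_EFinP; apply: measurable_fun_cvg mf_ _ => x _; exact: f_f.
- by apply/aeW => x _; apply: cvg_EFin; [exact: nearW|exact: f_f].
- by apply/aeW => x k _; rewrite lee_fin.
- by [].
Qed.

(** * Polynomial iterates converging to the sign function *)

Section CubicSign.
Variable R : realType.
Implicit Types v x : R.

(* Maps [-1, 1] into itself with attracting fixed points -1 and 1, so that its
   iterates converge to the sign function. *)
Definition cubic_step v : R := (3 * v - v ^+ 3) / 2.

Lemma cubic_step_gt0 v : 0 < v <= 1 -> v <= cubic_step v <= 1.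
Proof.
move=> /andP[v0 v1]; rewrite -subr_ge0 -[_ v <= 1]subr_ge0 /cubic_step.
have -> : (3 * v - v ^+ 3) / 2 - v = v * ((1 - v) * (1 + v)) / 2 by field.
have -> : 1 - (3 * v - v ^+ 3) / 2 = (1 - v) * ((1 - v) * (2 + v)) / 2 by field.
by rewrite !divr_ge0 ?mulr_ge0//; lra.
Qed.

Lemma cubic_step_odd v : cubic_step (- v) = - cubic_step v.
Proof. by rewrite /cubic_step; field. Qed.

Lemma iter_cubic_step_odd m v :
  iter m cubic_step (- v) = - iter m cubic_step v.
Proof. by elim: m => //= m ->; exact: cubic_step_odd. Qed.

(** With u the current iterate, 1 - [cubic_step u] = (1 - u) (1 - u)(2 + u)/2, and (1 - u)(2 + u)/2
    <= 1 - u/2 <= 1 - v/2 because the iterates increase from v. So the distance to 1 decays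
    geometrically. *)
Lemma iter_cubic_step_bound m v : 0 < v <= 1 ->
  [/\ v <= iter m cubic_step v, iter m cubic_step v <= 1 &
      1 - iter m cubic_step v <= (1 - v / 2) ^+ m].
Proof.
move=> v01; have /andP[v0 v1] := v01; elim: m => [|m [IH1 IH2 IH3]] /=.
  by rewrite expr0; split => //; lra.
set u := iter m cubic_step v in IH1 IH2 IH3 *.
have /andP[u1 u2] : u <= cubic_step u <= 1.
  by apply: cubic_step_gt0; rewrite IH2 andbT; exact: lt_le_trans IH1.
split; [exact: le_trans u1|exact: u2|].
rewrite exprS; apply: (@le_trans _ _ ((1 - v / 2) * (1 - u))); last first.
  by rewrite ler_wpM2l//; lra.
have -> : 1 - cubic_step u = (1 - u) * ((1 - u) * (2 + u) / 2).
  by rewrite /cubic_step; field.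
rewrite mulrC ler_wpM2r; [by []|lra|].
rewrite ler_pdivrMr//; nra.
Qed.

Lemma cvg_iter_cubic_step v : `|v| <= 1 ->
  iter m cubic_step v @[m --> \oo] --> Num.sg v.
Proof.
have pos x : 0 < x <= 1 -> iter m cubic_step x @[m --> \oo] --> (1 : R).
  move=> x01; have /andP[x0 x1] := x01.
  apply: (@squeeze_cvgr _ _ _ _ (fun m => 1 - (1 - x / 2) ^+ m) (cst 1)).
  - apply: nearW => m; have [_ ? ?] := iter_cubic_step_bound m x01.
    by apply/andP; split => /=; lra.
  - rewrite -[X in _ --> X]subr0; apply: cvgB; first exact: cvg_cst.
    by apply: cvg_expr; rewrite ger0_norm; lra.
  - exact: cvg_cst.
rewrite ler_norml => /andP[v1 v2]; case: (ltgtP v 0) => [v0|v0|->].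
- rewrite ltr0_sg// -[v]opprK; under eq_fun do rewrite iter_cubic_step_odd.
  by apply: cvgN; apply: pos; apply/andP; split; lra.
- by rewrite gtr0_sg//; apply: pos; rewrite v0.
- rewrite sgr0 (_ : (fun m => iter m cubic_step 0) = cst 0); first exact: cvg_cst.
  apply/funext => m; elim: m => //= m ->.
  by rewrite /cubic_step; field.
Qed.

Lemma iter_cubic_step_le1 m v : `|v| <= 1 -> `|iter m cubic_step v| <= 1.
Proof.
have pos x : 0 < x <= 1 -> `|iter m cubic_step x| <= 1.
  move=> x01; have [? ? _] := iter_cubic_step_bound m x01.
  by rewrite ger0_norm//; lra.
rewrite ler_norml => /andP[v1 v2]; case: (ltgtP v 0) => [v0|v0|->].
- by rewrite -[v]opprK iter_cubic_step_odd normrN pos//; apply/andP; split; lra.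
- by rewrite pos// v0.
- suff -> : iter m cubic_step 0 = 0 by rewrite normr0.
  by elim: m {pos} => //= m ->; rewrite /cubic_step; field.
Qed.

(** Once |x|/(k+1) < pi, the sine has the sign of x, so the sequence is eventually constant. *)
Lemma cvg_sg_sin_div x :
  Num.sg (sin (x / k.+1%:R)) @[k --> \oo] --> Num.sg x.
Proof.
apply: (cvg_near_cst); near=> k.
have xk : `|x| / k.+1%:R < pi.
  rewrite ltr_pdivrMr// -ltr_pdivrMl ?pi_gt0// -natr1.
  apply: (@lt_trans _ _ k%:R); last by rewrite ltrDl.
  by near: k; exact: nbhs_infty_gtr.
case: (ltgtP x 0) xk => [x0|x0|->] xk.
- rewrite ltr0_norm// in xk; rewrite -[x]opprK mulNr sinN !sgrN.
  have s0 : 0 < sin (- x / k.+1%:R) by rewrite sin_gt0_pi// xk divr_gt0 ?oppr_gt0.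
  by rewrite (gtr0_sg s0) (ltr0_sg x0) opprK.
- rewrite gtr0_norm// in xk.
  have s0 : 0 < sin (x / k.+1%:R) by rewrite sin_gt0_pi// xk divr_gt0.
  by rewrite (gtr0_sg s0) gtr0_sg.
- by rewrite mul0r sin0.
Unshelve. all: by end_near. Qed.

End CubicSign.

(** * Functions generated by cosines, and laws determined by them *)

Section TrigClosure.
Variables (R : realType) (n : nat).
Local Notation tupR := (n.-tuple (measurableTypeR R)).
Implicit Types (f g : tupR -> R) (t : 'I_n -> R) (c : R).

(** The phase c provides the sines (c = - pi/2) and the constant 1 (t = 0, c = 0), and makes
    products of two such functions expressible by their sums. *)
Definition trig_mono t c : tupR -> R := fun y => cos (\sum_i t i * tnth y i + c).

(** The bound K in the limit clause is uniform in k and y: equality of expectations then passes to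
    the limit by dominated convergence. *)
Inductive trig_closure : (tupR -> R) -> Prop :=
| trig_closure_cos t c : trig_closure (trig_mono t c)
| trig_closure_lin a f g : trig_closure f -> trig_closure g ->
    trig_closure (fun y => a * f y + g y)
| trig_closure_lim (f_ : nat -> tupR -> R) g (K : R) :
    (forall k, trig_closure (f_ k)) -> (forall k y, `|f_ k y| <= K) ->
    (forall y, f_ k y @[k --> \oo] --> g y) -> trig_closure g.

Lemma cvg_norm_le (u : nat -> R) (l K : R) :
  (forall k, `|u k| <= K) -> u k @[k --> \oo] --> l -> `|l| <= K.
Proof.
move=> uK ul; have nl : `|u k| @[k --> \oo] --> `|l| by exact: cvg_norm.
rewrite -(cvg_lim _ nl)//; apply: limr_le; first by apply/cvg_ex; eexists; exact: nl.
exact: nearW.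
Qed.

Lemma trig_mono_le1 t c y : `|trig_mono t c y| <= 1.
Proof. by rewrite ler_norml cos_geN1 cos_le1. Qed.

Lemma trig_closure_bounded f : trig_closure f ->
  measurable_fun setT f /\ exists K, forall y, `|f y| <= K.
Proof.
elim=> [t c|a {}f g _ [mf [K fK]] _ [mg [L gL]]|f_ g K _ IH fK fg].
- split; last by exists 1 => y; exact: trig_mono_le1.
  apply: measurableT_comp; first by apply: continuous_measurable_fun; exact: continuous_cos.
  apply: measurable_funD => //; apply: measurable_sum => i.
  by apply: measurable_funM => //; exact: measurable_tnth.
- split; first by apply: measurable_funD => //; exact: measurable_funM.
  exists (`|a| * K + L) => y; rewrite (le_trans (ler_normD _ _))// lerD//.
  by rewrite normrM ler_wpM2l.
- split; last by exists K => y; exact: cvg_norm_le (fg y).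
  by apply: (@measurable_fun_cvg _ _ _ _ f_) => [k|y _]; [exact: (IH k).1|exact: fg].
Qed.

Lemma trig_closure1 : trig_closure (fun=> 1).
Proof.
rewrite (_ : (fun=> 1) = trig_mono (fun=> 0) 0); first exact: trig_closure_cos.
apply/funext => y; rewrite /trig_mono addr0 big1 ?cos0// => i _.
by rewrite mul0r.
Qed.

Lemma trig_closure0 : trig_closure (fun=> 0).
Proof.
rewrite (_ : (fun=> 0) = (fun y : tupR => (-1) * 1 + 1)).
  by apply: (trig_closure_lin _ trig_closure1 trig_closure1).
by apply/funext => y; rewrite mulr1 addNr.
Qed.

Lemma trig_closureZ a f : trig_closure f -> trig_closure (fun y => a * f y).
Proof.
move=> cf; rewrite (_ : (fun _ => _) = (fun y => a * f y + 0)).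
  exact: (trig_closure_lin _ cf trig_closure0).
by apply/funext => y; rewrite addr0.
Qed.

(** Induction on [f], and on [g] when [f] is a cosine. The base case is the product-to-sum formula;
    in a limit, the other factor is bounded, which preserves the uniform bound. *)
Lemma trig_closureM f g : trig_closure f -> trig_closure g ->
  trig_closure (fun y => f y * g y).
Proof.
move=> cf cg; have [_ [L gL]] := trig_closure_bounded cg.
elim: cf => [t c|a {}f h cf IHf ch IHh|f_ h K cf IH fK fh].
- elim: cg => [t' c'|a {gL}g h cg IHg ch IHh|{gL}g_ h K cg IH gK gh].
  + rewrite (_ : (fun _ => _) = (fun y => 2^-1 * trig_mono (fun i => t i + t' i) (c + c') y
        + 2^-1 * trig_mono (fun i => t i - t' i) (c - c') y)).
      apply: trig_closure_lin; first exact: trig_closure_cos.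
      exact: trig_closureZ (trig_closure_cos _ _).
    apply/funext => y; rewrite /trig_mono.
    set u := \sum_i t i * tnth y i; set v := \sum_i t' i * tnth y i.
    have -> : \sum_i (t i + t' i) * tnth y i + (c + c') = (u + c) + (v + c').
      rewrite addrACA; congr (_ + _); rewrite -big_split; apply: eq_bigr => i _.
      by rewrite mulrDl.
    have -> : \sum_i (t i - t' i) * tnth y i + (c - c') = (u + c) - (v + c').
      rewrite opprD addrACA; congr (_ + _); rewrite -sumrN -big_split.
      by apply: eq_bigr => i _; rewrite mulrBl.
    by rewrite (cosD (u + c)) (cosB (u + c)); field.
  + rewrite (_ : (fun _ => _) = (fun y =>
      a * (trig_mono t c y * g y) + trig_mono t c y * h y)).
      exact: trig_closure_lin.
    by apply/funext => y; ring.
  + apply: (trig_closure_lim (f_ := fun k y => trig_mono t c y * g_ k y) (K := K)) => //.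
      by move=> k y; rewrite normrM -[K]mul1r ler_pM// trig_mono_le1.
    by move=> y; apply: cvgMr; exact: gh.
- rewrite (_ : (fun _ => _) = (fun y => a * (f y * g y) + h y * g y)).
    exact: trig_closure_lin.
  by apply/funext => y; ring.
- apply: (trig_closure_lim (f_ := fun k y => f_ k y * g y) (K := K * L)) => //.
    by move=> k y; rewrite normrM ler_pM.
  by move=> y; apply: cvgMl; exact: fh.
Qed.

Lemma trig_closure_cubic_step f : trig_closure f ->
  trig_closure (fun y => cubic_step (f y)).
Proof.
move=> cf; rewrite (_ : (fun _ => _) = (fun y =>
    (3 / 2) * f y + (- 2^-1) * (f y * (f y * f y)))).
  apply: trig_closure_lin => //; apply: trig_closureZ.
  by do 2 apply: trig_closureM => //.
by apply/funext => y; rewrite /cubic_step; field.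
Qed.

(** Two nested limits: for fixed k, iterating [cubic_step] on sin((y_i - x)/(k+1)) gives the sign of
    this sine, and then k grows. *)
Lemma trig_closure_sg (i : 'I_n) (x : R) :
  trig_closure (fun y => Num.sg (tnth y i - x)).
Proof.
pose s k (y : tupR) := sin ((tnth y i - x) / k.+1%:R).
have s_le1 k y : `|s k y| <= 1 by rewrite ler_norml sin_geN1 sin_le1.
have cs k : trig_closure (s k).
  rewrite (_ : s k = trig_mono (fun j => (j == i)%:R / k.+1%:R) (- x / k.+1%:R - pi / 2)).
    exact: trig_closure_cos.
  apply/funext => y; rewrite /trig_mono (bigD1 i)//= big1 => [|j /negbTE ->].
    by rewrite eqxx addr0 mul1r addrA cosBpihalf /s mulrBl mulrC mulNr.
  by rewrite !mul0r.
apply: (trig_closure_lim (f_ := fun k y => Num.sg (s k y)) (K := 1)) => [k|k y|y].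
- apply: (trig_closure_lim (f_ := fun m y => iter m (@cubic_step R) (s k y)) (K := 1)).
  + by elim=> [|m IH] /=; [exact: cs|exact: trig_closure_cubic_step].
  + by move=> m y; exact: iter_cubic_step_le1.
  + by move=> y; exact: cvg_iter_cubic_step.
- by rewrite normr_sg lern1 leq_b1.
- exact: cvg_sg_sin_div.
Qed.

(** Products give intersections and 1 - f gives complements, so finite unions are covered; countable
    unions are limits of these. The sets form a full sigma-algebra, so generators suffice, with no
    pi-lambda argument. *)
Lemma trig_closure_indic_sigma_algebra :
  sigma_algebra setT [set A | trig_closure \1_A].
Proof.
have cI A B : trig_closure \1_A -> trig_closure \1_B -> trig_closure \1_(A `&` B).
  by rewrite indicI; exact: trig_closureM.
have cC A : trig_closure \1_A -> trig_closure \1_(~` A).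
  move=> cA; rewrite (_ : \1_(~` A) = (fun y => (-1) * \1_A y + 1)).
    exact: trig_closure_lin _ trig_closure1.
  apply/funext => y; rewrite !indicE in_setC mulN1r.
  by case: (y \in A) => /=; rewrite ?oppr0 ?addNr ?add0r.
split=> /= [|A cA|F cF].
- by rewrite indic0; exact: trig_closure0.
- by rewrite setTD; exact: cC.
- apply: (trig_closure_lim (f_ := fun k => \1_(\big[setU/set0]_(i < k) F i)) (K := 1)).
  + elim=> [|k IH]; first by rewrite big_ord0 indic0; exact: trig_closure0.
    rewrite big_ord_recr /= -[X in \1_X]setCK setCU; apply/cC/cI; exact: cC.
  + by move=> k y; rewrite indicE normr_nat lern1 leq_b1.
  + move=> y; apply: cvg_near_cst.
    have [Fy|Fy] := pselect ((\bigcup_i F i) y); [have [m _ Fm] := Fy|]; near=> k.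
      rewrite !indicE !mem_set// -bigcup_mkord; exists m => //=.
      by near: k; exact: nbhs_infty_gt.
    rewrite !indicE !memNset// -bigcup_mkord => -[m _ Fm]; apply: Fy; by exists m.
Unshelve. all: by end_near. Qed.

(** For s in {-1, 0, 1}, (s^2 + s)/2 is the indicator of s = 1. *)
Lemma trig_closure_indic_gt (i : 'I_n) (x : R) :
  trig_closure \1_[set y | x < tnth y i].
Proof.
have cs := trig_closure_sg i x.
rewrite (_ : \1__ = (fun y => 2^-1 * (Num.sg (tnth y i - x) * Num.sg (tnth y i - x))
    + 2^-1 * Num.sg (tnth y i - x))).
  by apply: trig_closure_lin; [exact: trig_closureM|exact: trig_closureZ].
apply/funext => y; rewrite indicE; case: (ltgtP x (tnth y i)) => h.
- by rewrite mem_set// gtr0_sg ?subr_gt0//=; field.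
- rewrite memNset /=; last by rewrite ltNge (ltW h).
  by rewrite ltr0_sg ?subr_lt0//=; field.
- rewrite memNset /=; last by rewrite h ltxx.
  by rewrite -h subrr sgr0 /=; field.
Qed.

Lemma trig_closure_indic (A : set tupR) : measurable A -> trig_closure \1_A.
Proof.
have [s0 sC sU] := trig_closure_indic_sigma_algebra.
move: A; suff : measurable `<=` [set A : set tupR | trig_closure \1_A] by [].
apply: smallest_sub; first exact: trig_closure_indic_sigma_algebra.
suff coordS (i : 'I_n) (B : set (measurableTypeR R)) : measurable B ->
    trig_closure \1_((fun y : tupR => tnth y i) @^-1` B).
  (* The sigma-algebra on tuples is generated by the union over i of the preimages under the i-th
     coordinate, and each of these comes from half-lines. *)
  move=> A; apply: (big_ind (fun S : set (set tupR) => S A -> trig_closure \1_A)) => //.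
    by move=> S1 S2 h1 h2 [/h1|/h2].
  by move=> i _ [B mB <-]; rewrite setTI; exact: coordS.
have ME := @RGenOInfty.measurableE R.
suff : (@RGenOInfty.G R).-sigma.-measurable `<=`
    [set B : set (measurableTypeR R) | trig_closure \1_((fun y : tupR => tnth y i) @^-1` B)].
  by rewrite -ME => h mB; exact: h.
apply: smallest_sub.
  split=> [|C cC|F cF] /=.
  - by rewrite preimage_set0.
  - by rewrite setTD preimage_setC -setTD; exact: sC.
  - by rewrite preimage_bigcup; exact: sU.
move=> _ [x ->] /=; have := trig_closure_indic_gt i x.
by congr trig_closure; congr indic; apply/seteqP; split => y /=; rewrite in_itv /= andbT.
Qed.

End TrigClosure.

Section TrigDeterminesLaw.
Variables (R : realType) (n : nat).
Local Notation tupR := (n.-tuple (measurableTypeR R)).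
Context (d1 d2 : measure_display) (T1 : measurableType d1) (T2 : measurableType d2).
Variables (P1 : probability T1 R) (P2 : probability T2 R).
Variables (Y1 : T1 -> tupR) (Y2 : T2 -> tupR).
Hypotheses (mY1 : measurable_fun setT Y1) (mY2 : measurable_fun setT Y2).

Lemma bounded_integrable d (T : measurableType d) (P : probability T R) (f : T -> R) K :
  measurable_fun setT f -> (forall x, `|f x| <= K) -> P.-integrable setT (EFin \o f).
Proof.
move=> mf fK; apply: (@le_integrable _ _ _ _ _ measurableT _ (EFin \o cst K)).
- exact/measurable_EFinP.
- by move=> x _; rewrite lee_fin (le_trans (fK x))// ler_norm.
- exact: finite_measure_integrable_cst.
Qed.

Lemma trig_determines_law :
  (forall t c, \int[P1]_x (trig_mono t c (Y1 x))%:E =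
               \int[P2]_x (trig_mono t c (Y2 x))%:E)%E ->
  forall A, measurable A -> P1 (Y1 @^-1` A) = P2 (Y2 @^-1` A).
Proof.
move=> ecos A mA.
suff H f : trig_closure f -> (\int[P1]_x (f (Y1 x))%:E = \int[P2]_x (f (Y2 x))%:E)%E.
  have := H _ (trig_closure_indic mA).
  have E d (T : measurableType d) (P : probability T R) (Y : T -> tupR) :
      measurable_fun setT Y -> (\int[P]_x (\1_A (Y x))%:E = P (Y @^-1` A))%E.
    move=> mY; rewrite -[in RHS](setIT (Y @^-1` A)) -integral_indic//.
    by rewrite -[X in measurable X]setTI; exact: mY.
  by rewrite !E.
have int d (T : measurableType d) (P : probability T R) (Y : T -> tupR) g :
    measurable_fun setT Y -> trig_closure g ->
    measurable_fun setT (g \o Y) /\ P.-integrable setT (EFin \o (g \o Y)).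
  move=> mY /trig_closure_bounded[mg [K gK]].
  have mgY : measurable_fun setT (g \o Y) by exact: measurableT_comp mY.
  by split=> //; apply: (@bounded_integrable _ _ P _ K mgY) => x; exact: gK.
elim=> {f} [t c|a f g cf IHf cg IHg|f_ g K cf IH fK fg]; first exact: ecos.
- have E d (T : measurableType d) (P : probability T R) (Y : T -> tupR) :
      measurable_fun setT Y ->
      (\int[P]_x (a * f (Y x) + g (Y x))%:E =
       a%:E * \int[P]_x (f (Y x))%:E + \int[P]_x (g (Y x))%:E)%E.
    move=> mY; have [_ If] := int _ _ P _ _ mY cf; have [_ Ig] := int _ _ P _ _ mY cg.
    under eq_integral do rewrite EFinD EFinM.
    rewrite integralD//; first by rewrite integralZl.
    exact: integrableZl.
  by rewrite !E// IHf IHg.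
- have E d (T : measurableType d) (P : probability T R) (Y : T -> tupR) :
      measurable_fun setT Y ->
      (\int[P]_x (f_ k (Y x))%:E @[k --> \oo] --> \int[P]_x (g (Y x))%:E)%E.
    move=> mY; have [|||_] := @dominated_cvg_integral _ _ _ P (fun k => f_ k \o Y)
      (g \o Y) (cst K) _ _ _ (finite_measure_integrable_cst _ _ measurableT) => //.
    + by move=> k; exact: (int _ _ P _ _ mY (cf k)).1.
    + by move=> x; exact: fg.
    + by move=> k x; exact: fK.
  have E2 := E _ _ P2 _ mY2.
  rewrite -(cvg_lim _ (E _ _ P1 _ mY1))// -(cvg_lim _ E2)//.
  by congr (lim (_ @ \oo)); apply/funext => k.
Qed.

End TrigDeterminesLaw.

(** * Second-order calculus in coordinates *)

Section SecondOrderCalculus.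
Variables (R : realType) (V : normedModType R) (n : nat).
Variables (e : 'I_n -> V) (x : 'I_n -> V -> R).
Hypothesis x_cont : forall a, continuous (x a).
Hypothesis xD : forall a S T, x a (S + T) = x a S + x a T.
Hypothesis xE : forall S, S = \sum_a x a S *: e a.
Variable f : V -> R.
Hypothesis C2f : C2 f.

Lemma coord0 a : x a 0 = 0.
Proof. by apply: (addrI (x a 0)); rewrite -xD !addr0. Qed.

Lemma linear_expansion (l : {linear V -> R}) S : l S = \sum_a x a S * l (e a).
Proof. by rewrite {1}(xE S) linear_sum; apply: eq_bigr => a _; rewrite linearZ. Qed.

Lemma linear_cvg0 (l : {linear V -> R}) : l H @[H --> 0] --> (0 : R).
Proof.
have lE : (l : V -> R) = (fun H => \sum_a x a H * l (e a)).
  by apply/funext => H; exact: linear_expansion.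
have : (\sum_a x a H * l (e a)) @[H --> 0] --> \sum_a x a 0 * l (e a).
  apply: cvg_big => [|a _]; first exact: add_continuous.
  by apply: cvgMr_tmp; exact: x_cont.
have -> : \sum_a x a 0 * l (e a) = 0 by rewrite big1// => a _; rewrite coord0 mul0r.
by rewrite -lE.
Qed.

(** [D2] is a ['d], and that it is a genuine derivative comes from the second clause of [C2],
    applied to increments h v and divided by h. The added 1's in [K] keep it positive when U or v is
    0. *)
Lemma is_derive_D1 S U v : is_derive S v (fun T => 'd f T U) (D2 f S U v).
Proof.
have [_ C2f2 _] := C2f.
have lim : (fun h : R => h^-1 *: (((fun T => 'd f T U) \o shift S) (h *: v) - 'd f S U))
    @ 0^' --> D2 f S U v.
  apply/cvgrPdist_le => /= eps eps0.
  pose K := (`|v| + 1) * (`|U| + 1).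
  have K0 : 0 < K by rewrite mulr_gt0// ltr_wpDl.
  have eK0 : 0 < eps / K by rewrite divr_gt0.
  have := C2f2 S _ eK0 => hH.
  have hs : \forall h \near (0 : R), forall U0, `|'d f (S + h *: v) U0 - 'd f S U0 -
      D2 f S U0 (h *: v)| <= eps / K * `|h *: v| * `|U0|.
    have c0 : (h *: v) @[h --> (0 : R)] --> (0 : V).
      by rewrite -[X in _ --> X](scale0r v); apply: cvgZr_tmp; exact: cvg_id.
    exact: c0 hH.
  near=> h.
  have h0 : h != 0 by near: h; exact: nbhs_dnbhs_neq.
  have hU : `|'d f (S + h *: v) U - 'd f S U - D2 f S U (h *: v)| <=
      eps / K * `|h *: v| * `|U|.
    by move: (U); near: h; apply: nbhs_dnbhs.
  have D2Z : D2 f S U (h *: v) = h * D2 f S U v by rewrite /D2 linearZ.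
  rewrite /= [h *: v + S]addrC -(ler_pM2l (x := `|h|)) ?normr_gt0//.
  rewrite -normrM mulrBr -D2Z [h * (h^-1 *: _)]mulrA mulfV// mul1r distrC.
  apply: le_trans hU _; rewrite normrZ.
  have -> : eps / K * (`|h| * `|v|) * `|U| = `|h| * eps * (`|v| * `|U| / K) by ring.
  rewrite ler_piMr ?mulr_ge0 ?(ltW eps0)// ler_pdivrMr// mul1r.
  by rewrite ler_pM// lerDl.
have d : derivable (fun T => 'd f T U) S v by apply/cvg_ex; eexists; exact: lim.
by apply: DeriveDef => //; exact: cvg_lim lim.
Unshelve. all: by end_near. Qed.

Lemma D1_continuous U : continuous (fun S => 'd f S U).
Proof.
move=> S; have [_ C2f2 _] := C2f; apply/cvgrPdist_le => /= eps eps0.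
pose K := `|U| + 1.
have K0 : 0 < K by rewrite ltr_wpDl.
have hH := C2f2 S 1 ltr01.
have hl : \forall H \near (0 : V), `|D2 f S U H| <= eps / 2.
  have /cvgr0_norm_le := @linear_cvg0 ('d (fun T => 'd f T U) S).
  by apply; rewrite divr_gt0.
have hn : \forall H \near (0 : V), `|H| <= eps / 2 / K.
  apply/nbhs_normP; exists (eps / 2 / K); first by rewrite /= !divr_gt0.
  by move=> H /=; rewrite sub0r normrN => /ltW.
have : \forall H \near (0 : V), `|'d f S U - 'd f (S + H) U| <= eps.
  near=> H.
  have h1 : `|'d f (S + H) U - 'd f S U - D2 f S U H| <= 1 * `|H| * `|U|.
    by move: (U); near: H.
  have h2 : `|D2 f S U H| <= eps / 2 by near: H.
  have h3 : `|H| <= eps / 2 / K by near: H.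
  have h4 : 1 * `|H| * `|U| <= eps / 2.
    rewrite mul1r; apply: (@le_trans _ _ (eps / 2 / K * K)); last by rewrite divfK// gt_eqF.
    by rewrite ler_pM// lerDl.
  rewrite distrC; move: h1 h2; rewrite !ler_norml => /andP[? ?] /andP[? ?].
  by apply/andP; split; lra.
by move=> h; apply/nbhs0P.
Unshelve. all: by end_near. Qed.

Lemma D2_continuous U W : continuous (fun S => D2 f S U W).
Proof.
move=> S; have [_ _ C2f3] := C2f; apply/cvgrPdist_le => /= eps eps0.
pose K := (`|U| + 1) * (`|W| + 1).
have K0 : 0 < K by rewrite mulr_gt0// ltr_wpDl.
have eK0 : 0 < eps / K by rewrite divr_gt0.
apply: filterS (C2f3 S _ eK0) => T /(_ U W) h.
rewrite distrC; apply: le_trans h _.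
rewrite -mulrA mulrAC ler_pdivrMr// ler_wpM2l ?(ltW eps0)//.
by rewrite /K ler_pM// lerDl.
Qed.

(** Linearity in W is that of ['d]. Linearity in U is not built in: the map T |-> ['d f T U] is
    expanded in the basis and differentiated term by term, and the two values of the same derivative
    are compared. *)
Lemma D2_expansion S U W :
  D2 f S U W = \sum_a \sum_b x a U * x b W * D2 f S (e a) (e b).
Proof.
rewrite /D2 (linear_expansion ('d (fun T => 'd f T U) S)) exchange_big /=.
apply: eq_bigr => b _.
under eq_bigr do rewrite [x _ U * _]mulrC -mulrA.
rewrite -mulr_sumr; congr (_ * _).
have h1 := is_derive_D1 S U (e b).
have h2 : is_derive S (e b) (\sum_a (x a U \*: (fun T => 'd f T (e a))))
    (\sum_a x a U *: D2 f S (e a) (e b)).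
  by apply: is_derive_sum => a; apply: is_deriveZ; exact: is_derive_D1.
have fE : \sum_a (x a U \*: (fun T => 'd f T (e a))) = (fun T => 'd f T U).
  apply/funext => T; rewrite fct_sumE; rewrite [RHS](linear_expansion ('d f T)).
  by apply: eq_bigr.
rewrite fE in h2.
by rewrite -[LHS](@derive_val _ _ _ _ _ _ _ h1) (@derive_val _ _ _ _ _ _ _ h2).
Qed.

End SecondOrderCalculus.

(** * The cut-off Gaussian profile *)

Section Cutoff.
Variable R : realType.
Implicit Types t q k : R.

Definition pos_part t : R := Num.max 0 t.

Lemma pos_part_ge0 t : 0 <= pos_part t.
Proof. by rewrite le_max lexx. Qed.

Lemma pos_part_le0 t : t <= 0 -> pos_part t = 0.
Proof. by move=> t0; rewrite /pos_part max_l. Qed.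

Lemma pos_part_id t : 0 <= t -> pos_part t = t.
Proof. by move=> t0; rewrite /pos_part max_r. Qed.

Lemma continuous_pos_part : continuous pos_part.
Proof. by move=> t; apply: continuous_max; [exact: cvg_cst|exact: cvg_id]. Qed.

(** In every configuration of signs the first-order remainder lies between 0 and h^2. Squaring is
    what makes the truncation C^1 at the boundary of its support. *)
Lemma is_derive_pos_part_sqr t :
  is_derive t (1 : R) (fun s => pos_part s ^+ 2) (2 * pos_part t).
Proof.
have bd h : 0 <= pos_part (h + t) ^+ 2 - pos_part t ^+ 2 - 2 * pos_part t * h <= h ^+ 2.
  have [t0|t0] := leP 0 t; have [ht|ht] := leP 0 (h + t);
    rewrite ?(pos_part_id t0) ?(pos_part_id ht)
      ?(pos_part_le0 (ltW t0)) ?(pos_part_le0 (ltW ht));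
    by apply/andP; split; nra.
have lim : (fun h : R => h^-1 *: (((fun s => pos_part s ^+ 2) \o shift t) (h *: 1) -
    pos_part t ^+ 2)) @ 0^' --> 2 * pos_part t.
  apply/cvgrPdist_le => /= eps eps0; near=> h.
  have h0 : h != 0 by near: h; exact: nbhs_dnbhs_neq.
  have he : `|h| <= eps.
    near: h; apply: nbhs_dnbhs; apply/nbhs_normP; exists eps => // y /=.
    by rewrite sub0r normrN => /ltW.
  rewrite [h *: 1]mulr1 -(ler_pM2l (x := `|h|)) ?normr_gt0//.
  rewrite -normrM mulrBr [h * (h^-1 *: _)]mulrA mulfV// mul1r distrC [h * _]mulrC.
  have /andP[b1 b2] := bd h; rewrite ger0_norm//; apply: le_trans b2 _.
  by rewrite -normr_id -[h ^+ 2]ger0_norm ?sqr_ge0// normrX normr_id expr2 ler_wpM2l.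
have d : derivable (fun s => pos_part s ^+ 2) t 1 by apply/cvg_ex; eexists; exact: lim.
by apply: DeriveDef => //; exact: cvg_lim lim.
Unshelve. all: by end_near. Qed.

(* A function of the Mahalanobis form q: a C^1 cut-off vanishing for q >= 1/k and
   tending to 1 as k -> 0, times the Gaussian factor. *)
Definition cutoff_gauss k q : R := pos_part (1 - k * q) ^+ 2 * expR (- q / 2).

Definition dcutoff_gauss k q : R :=
  - 2 * k * pos_part (1 - k * q) * expR (- q / 2) - 2^-1 * cutoff_gauss k q.

Lemma is_derive_cutoff_gauss k q :
  is_derive q (1 : R) (cutoff_gauss k) (dcutoff_gauss k q).
Proof.
have d1 : is_derive q (1 : R) (fun q => 1 - k * q) (- k).
  apply: (is_derive_eq (is_deriveB (is_derive_cst (1 : R) q (1 : R))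
    (is_deriveZ k (is_derive_id q (1 : R))))).
  by rewrite sub0r -[k *: 1]/(k * 1) mulr1.
have d2 : is_derive q (1 : R) (fun q => - q / 2) (- 2^-1).
  rewrite (_ : (fun _ => _) = (fun q => (- 2^-1) * q)); last by apply/funext => s; ring.
  apply: (is_derive_eq (is_deriveZ (- 2^-1) (is_derive_id q (1 : R)))).
  by rewrite -[X in X = _]/(- 2^-1 * 1) mulr1.
have d3 := is_derive1_comp (is_derive_pos_part_sqr _) d1.
have d4 := is_derive1_comp (is_derive_expR _) d2.
apply: is_derive_eq (is_deriveM d3 d4) _ => /=.
by rewrite /dcutoff_gauss /cutoff_gauss /GRing.scale /=; ring.
Qed.

Lemma continuous_cutoff_gauss k : continuous (cutoff_gauss k).
Proof.
move=> q; apply/differentiable_continuous/derivable1_diffP.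
have h := is_derive_cutoff_gauss k q; exact: ex_derive.
Qed.

Lemma continuous_dcutoff_gauss k : continuous (dcutoff_gauss k).
Proof.
move=> q; apply: cvgB; last by apply: cvgMl_tmp; exact: continuous_cutoff_gauss.
apply: cvgM.
  apply: cvgMl_tmp; apply: continuous_cvg; first exact: continuous_pos_part.
  by apply: cvgB; [exact: cvg_cst|apply: cvgMl_tmp; exact: cvg_id].
apply: continuous_cvg; first exact: continuous_expR.
by apply: cvgMr_tmp; apply: cvgN; exact: cvg_id.
Qed.

Lemma cutoff_gauss_eq0 k q : 1 <= k * q -> cutoff_gauss k q = 0 /\ dcutoff_gauss k q = 0.
Proof.
move=> kq; have p0 : pos_part (1 - k * q) = 0 by rewrite pos_part_le0// subr_le0.
by rewrite /dcutoff_gauss /cutoff_gauss p0 expr0n /= !(mulr0, mul0r) subr0.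
Qed.

End Cutoff.

(** * Integrals of compactly supported derivatives *)

Lemma is_derive_comp1 (R : realType) (V : normedModType R) (phi : R -> R) (g : V -> R)
    (S v : V) (dg dphi : R) :
  is_derive S v g dg -> is_derive (g S) (1 : R) phi dphi ->
  is_derive S v (phi \o g) (dphi * dg).
Proof.
move=> /is_derive_line dG dP; apply/is_derive_line.
apply: (@is_derive1_comp _ phi (fun s => g (S + s *: v))) => //.
by rewrite scale0r addr0.
Qed.

Section CompactSupportDivergence.
Variables (R : realType) (V : normedModType R) (n : nat).
Variables (e : 'I_n -> V) (x : 'I_n -> V -> R).
Local Notation tupR := (n.-tuple (measurableTypeR R)).
Local Notation leb := (tuple_lebesgue R n).
Definition of_coords (y : tupR) : V := \sum_a tnth y a *: e a.
Hypothesis xK : forall (y : tupR) b, x b (of_coords y) = tnth y b.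

Lemma of_coords_tshift y a s : of_coords (tshift y a s) = of_coords y + s *: e a.
Proof.
rewrite /of_coords [in RHS](bigD1 a)//= (bigD1 a)//= tnth_mktuple eqxx scalerDl.
rewrite [RHS]addrAC; congr (_ + _).
by apply: eq_bigr => b /negbTE ba; rewrite tnth_mktuple ba addr0.
Qed.

Lemma bounded_on_tbox (g : V -> R) (K : R) : continuous g ->
  exists B, forall y : tupR, (forall i, `|tnth y i| <= K) -> `|g (of_coords y)| <= B.
Proof.
move=> cg; pose m (v : 'rV[R]_n) := g (\sum_a v ord0 a *: e a).
pose A := [set v : 'rV[R]_n | forall i, `[-K, K]%classic (v ord0 i)].
have cA : compact A.
  by apply: (@rV_compact R n (fun=> `[- K, K]%classic)) => i; exact: segment_compact.
have cm : continuous m.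
  have cc a : continuous (fun v : 'rV[R]_n => v ord0 a).
    exact: (@coord_continuous R 1 n ord0 a).
  have cs : continuous (fun v : 'rV[R]_n => \sum_a v ord0 a *: e a).
    apply: continuous_big => [|a _ v]; first exact: add_continuous.
    by apply: (@cvgZr_tmp _ _ _ (nbhs v)); exact: cc.
  by move=> v; apply: (continuous_comp (cs v)); exact: cg.
have [B [_ hB]] : bounded_set (m @` A).
  by apply: compact_bounded; apply: continuous_compact => //; exact: continuous_subspaceT.
exists (B + 1) => y yK; apply: hB; first by rewrite ltrDl.
exists (\row_a tnth y a); last by rewrite /m; under eq_bigr do rewrite mxE.
by move=> i; rewrite /= mxE in_itv /= -ler_norml.
Qed.

Lemma integral_directional_derive_eq0 (a : 'I_n) (F dF : V -> R) (K : R) :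
  (forall S, is_derive S (e a) F (dF S)) -> continuous dF ->
  (forall S i, K < `|x i S| -> F S = 0 /\ dF S = 0) ->
  leb.-integrable setT (EFin \o (dF \o of_coords)) /\
  (\int[leb]_y (dF (of_coords y))%:E = 0)%E.
Proof.
move=> dFF cdF FK.
have mdF : measurable_fun setT (dF \o of_coords) by exact: measurable_comp_lincomb.
have FK' (y : tupR) i : K < `|tnth y i| -> F (of_coords y) = 0 /\ dF (of_coords y) = 0.
  by move=> yK; apply: (FK _ i); rewrite xK.
have [B0 hB0] := bounded_on_tbox K cdF.
(* The absolute value is for the points outside the box, where the bound is compared with 0: if the
   box is empty, the sign of [B0] is unknown. *)
have hB y : `|dF (of_coords y)| <= `|B0|.
  have [|/existsNP[i /negP]] := pselect (forall i, `|tnth y i| <= K).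
    by move=> /hB0 /le_trans; apply; exact: ler_norm.
  by rewrite -ltNge => /FK'[_ ->]; rewrite normr0.
split.
  by apply: (integrable_tbox_supported mdF hB) => y i /FK'[].
apply: (@integral_tuple_derive_eq0 _ _ a (F \o of_coords) _ K `|B0|) => //.
- move=> y; have /is_derive_line := dFF (of_coords y).
  congr is_derive; apply/funext => s /=; by rewrite of_coords_tshift.
- move=> y s; rewrite /=; under eq_fun do rewrite of_coords_tshift.
  apply: continuous_cvg; first exact: cdF.
  by apply: cvgD; [exact: cvg_cst|apply: cvgZr_tmp; exact: cvg_id].
Qed.

End CompactSupportDivergence.

Lemma integral_sum_eq0 d (T : measurableType d) (R : realType)
    (mu : {measure set T -> \bar R}) (I : Type) (r : seq I) (g : I -> T -> R) :
  (forall i, mu.-integrable setT (EFin \o g i) /\ (\int[mu]_y (g i y)%:E = 0)%E) ->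
  mu.-integrable setT (EFin \o (fun y => \sum_(i <- r) g i y)) /\
  (\int[mu]_y (\sum_(i <- r) g i y)%:E = 0)%E.
Proof.
move=> hg; elim: r => [|i r [IH1 IH2]].
  rewrite (_ : (fun y => _) = (fun=> 0)); last by apply/funext => y; rewrite big_nil.
  split; first exact: (@integrable0 _ _ _ mu setT).
  by under eq_integral do rewrite big_nil; exact: integral0.
have [h1 h2] := hg i; split.
  rewrite (_ : _ \o _ = ((EFin \o g i) \+ (EFin \o (fun y => (\sum_(j <- r) g j y)%R)))%E).
    exact: integrableD.
  by apply/funext => y /=; rewrite big_cons.
under eq_integral do rewrite big_cons EFinD.
by rewrite integralD// h2 IH2 adde0.
Qed.

(** * The Stein identity with cut-off *)

Section TruncatedStein.
Variables (R : realType) (V : normedModType R) (n : nat).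
Variables (e : 'I_n -> V) (x : 'I_n -> V -> R).
Hypothesis x_cont : forall a, continuous (x a).
Hypothesis xD : forall a S T, x a (S + T) = x a S + x a T.
Hypothesis xZ : forall a c S, x a (c *: S) = c * x a S.
Hypothesis xe : forall a b, x b (e a) = (b == a)%:R.
Hypothesis xE : forall S, S = \sum_a x a S *: e a.
Local Notation tupR := (n.-tuple (measurableTypeR R)).
Local Notation leb := (tuple_lebesgue R n).
Variables (Om : 'M[R]_n) (M : V).
Hypothesis Om_sym : Om^T = Om.
Hypothesis Om_posdef : forall v : 'rV_n, v != 0 -> 0 < (v *m Om *m v^T) 0 0.

Definition centered (S : V) : 'rV[R]_n := \row_a (x a S - x a M).

Definition mahalanobis (S : V) : R :=
  (centered S *m invmx Om *m (centered S)^T) 0 0.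

Local Notation z := centered.
Local Notation Q := mahalanobis.
Local Notation st := (of_coords e).

Lemma coord_of_coords (y : tupR) b : x b (st y) = tnth y b.
Proof.
have xs (F : 'I_n -> V) : x b (\sum_a F a) = \sum_a x b (F a).
  by apply: (big_morph (x b)); [exact: xD|exact: coord0 xD _].
rewrite xs (bigD1 b)//= big1 => [|a ab]; rewrite xZ xe; first by rewrite eqxx mulr1 addr0.
by rewrite eq_sym (negbTE ab) mulr0.
Qed.

Lemma mahalanobis_ge0 S : 0 <= Q S.
Proof. exact: inv_form_ge0. Qed.

Lemma centered_continuous a : continuous (fun S => z S 0 a).
Proof.
rewrite (_ : (fun S => _) = (fun S => x a S - x a M)); last first.
  by apply/funext => S; rewrite mxE.
by move=> S; apply: cvgB; [exact: x_cont|exact: cvg_cst].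
Qed.

Lemma centeredO_continuous a : continuous (fun S => (z S *m invmx Om) 0 a).
Proof.
rewrite (_ : (fun S => _) = (fun S => \sum_b z S 0 b * invmx Om b a)); last first.
  by apply/funext => S; rewrite mxE.
move=> S; apply: cvg_big => [|b _]; first exact: add_continuous.
by apply: cvgMr_tmp; exact: centered_continuous.
Qed.

Lemma mahalanobis_continuous : continuous Q.
Proof.
rewrite (_ : Q = (fun S => \sum_b (z S *m invmx Om) 0 b * (z S)^T b 0)); last first.
  by apply/funext => S; rewrite /mahalanobis mxE.
move=> S; apply: cvg_big => [|b _]; first exact: add_continuous.
apply: cvgM; first exact: centeredO_continuous.
suff : continuous (fun T => (z T)^T b 0) by exact.
rewrite (_ : (fun T => _) = (fun T => z T 0 b)); first exact: centered_continuous.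
by apply/funext => T; rewrite mxE.
Qed.

(** Along S + s e_a the form is the polynomial Q + 2 s (z Om^-1)_a + s^2 (Om^-1)_aa. *)
Lemma is_derive_mahalanobis S a : is_derive S (e a) Q (2 * (z S *m invmx Om) 0 a).
Proof.
apply/is_derive_line.
set u := z S *m invmx Om; set o := invmx Om a a.
have sOi : (invmx Om)^T = invmx Om by rewrite trmx_inv Om_sym.
have zs s : z (S + s *: e a) = z S + s *: (delta_mx 0 a : 'rV[R]_n).
  apply/rowP => b; rewrite !mxE xD xZ xe eqxx /= eq_sym.
  by rewrite addrAC.
have Qs s : Q (S + s *: e a) = Q S + s * (2 * u 0 a) + s * s * o.
  have addE (A B : 'M[R]_1) : (A + B) 0 0 = A 0 0 + B 0 0 by rewrite mxE.
  have scaleE c (A : 'M[R]_1) : (c *: A) 0 0 = c * A 0 0 by rewrite mxE.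
  have ud : (u *m ((delta_mx 0 a : 'rV[R]_n))^T) 0 0 = u 0 a by rewrite trmx_delta -colE mxE.
  have du : ((delta_mx 0 a : 'rV[R]_n) *m invmx Om *m (z S)^T) 0 0 = u 0 a.
    have -> : (delta_mx 0 a : 'rV[R]_n) *m invmx Om *m (z S)^T =
        (u *m (delta_mx 0 a : 'rV[R]_n)^T)^T.
      by rewrite trmx_mul trmxK /u trmx_mul sOi mulmxA.
    by rewrite mxE ud.
  have dd : ((delta_mx 0 a : 'rV[R]_n) *m invmx Om *m ((delta_mx 0 a : 'rV[R]_n))^T) 0 0 = o.
    by rewrite -rowE trmx_delta -colE !mxE.
  rewrite /Q zs linearD /= linearZ /= !mulmxDl !mulmxDr.
  rewrite -!scalemxAl -!scalemxAr -/u !addE !scaleE ud du dd.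
  by rewrite /Q -/u; ring.
under eq_fun do rewrite Qs.
apply: (is_derive_eq (is_deriveD (is_deriveD (is_derive_cst (Q S) (0 : R) (1 : R))
  (is_deriveM (is_derive_id (0 : R) (1 : R)) (is_derive_cst (2 * u 0 a) (0 : R) (1 : R))))
  (is_deriveM (is_deriveM (is_derive_id (0 : R) (1 : R)) (is_derive_id (0 : R) (1 : R)))
    (is_derive_cst o (0 : R) (1 : R))))).
by rewrite /GRing.scale /=; ring.
Qed.

Section Divergence.
Variable f : V -> R.
Hypothesis C2f : C2 f.
Variable k : R.
Hypothesis k_gt0 : 0 < k.

Definition drift (S : V) : R := 'd f S (M - S).

Definition trace2 (S : V) : R := \sum_a \sum_b Om a b * D2 f S (e a) (e b).

Let G S a := \sum_b Om a b * 'd f S (e b).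
Let dG S a := \sum_b Om a b * D2 f S (e b) (e a).

Lemma drift_coords S : drift S = - \sum_b z S 0 b * 'd f S (e b).
Proof.
rewrite /drift -opprB linearN /=; congr (- _).
rewrite (linear_expansion xE); apply: eq_bigr => b _; rewrite mxE.
by rewrite xD -scaleN1r xZ mulN1r.
Qed.

Lemma drift_continuous : continuous drift.
Proof.
rewrite (_ : drift = (fun S => - \sum_b z S 0 b * 'd f S (e b))); last first.
  by apply/funext => S; exact: drift_coords.
move=> S; apply: cvgN; apply: cvg_big => [|b _]; first exact: add_continuous.
apply: cvgM; first exact: centered_continuous.
exact: (D1_continuous x_cont xD xE C2f).
Qed.

Lemma trace2_continuous : continuous trace2.
Proof.
move=> S; apply: cvg_big => [|a _]; first exact: add_continuous.
apply: cvg_big => [|b _]; first exact: add_continuous.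
by apply: cvgMl_tmp; exact: (D2_continuous C2f).
Qed.

Let F a S := cutoff_gauss k (Q S) * G S a.
Let dF a S := G S a * (dcutoff_gauss k (Q S) * (2 * (z S *m invmx Om) 0 a))
  + cutoff_gauss k (Q S) * dG S a.

Let is_derive_F a S : is_derive S (e a) (F a) (dF a S).
Proof.
have d1 := is_derive_comp1 (is_derive_mahalanobis S a) (is_derive_cutoff_gauss k (Q S)).
have d2 : is_derive S (e a) (\sum_b (Om a b \*: (fun T => 'd f T (e b))))
    (\sum_b Om a b *: D2 f S (e b) (e a)).
  by apply: is_derive_sum => b; apply: is_deriveZ; exact: is_derive_D1.
have E : \sum_b (Om a b \*: (fun T => 'd f T (e b))) = G^~ a.
  by apply/funext => T; rewrite fct_sumE.
rewrite E in d2.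
apply: is_derive_eq (is_deriveM d1 d2) _.
by rewrite addrC.
Qed.

Let dF_continuous a : continuous (dF a).
Proof.
move=> S; apply: cvgD; apply: cvgM.
- apply: cvg_big => [|b _]; first exact: add_continuous.
  by apply: cvgMl_tmp; exact: (D1_continuous x_cont xD xE C2f).
- apply: cvgM; last by apply: cvgMl_tmp; exact: centeredO_continuous.
  apply: continuous_cvg; first exact: continuous_dcutoff_gauss.
  exact: mahalanobis_continuous.
- apply: continuous_cvg; first exact: continuous_cutoff_gauss.
  exact: mahalanobis_continuous.
- apply: cvg_big => [|b _]; first exact: add_continuous.
  by apply: cvgMl_tmp; exact: (D2_continuous C2f).
Qed.

(** Where k Q < 1, coercivity gives z_i^2 <= Om_ii/k, and t <= 1 + t^2 then bounds |x_i| without a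
    square root. The sum serves all coordinates at once. *)
Let K := \sum_a (`|x a M| + 1 + Om a a / k).

Let F_support a S i : K < `|x i S| -> F a S = 0 /\ dF a S = 0.
Proof.
have Oge0 b : 0 <= Om b b / k by rewrite divr_ge0// ltW// (posdef_diag_gt0 Om_posdef).
move=> Kx; suff kQ : 1 <= k * Q S.
  have [h1 h2] := cutoff_gauss_eq0 kQ.
  by rewrite /F /dF h1 h2 !(mul0r, mulr0) addr0.
rewrite leNgt; apply/negP => kQ.
have Ki : `|x i M| + 1 + Om i i / k <= K.
  rewrite /K (bigD1 i)//= lerDl sumr_ge0// => b _.
  by rewrite addr_ge0// addr_ge0.
have co := inv_form_coercive Om_sym Om_posdef (z S) i.
have zx : `|x i S| <= `|x i M| + `|z S 0 i|.
  by rewrite mxE -{1}(subrK (x i M) (x i S)) addrC ler_normD.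
have z2 : `|z S 0 i| ^+ 2 <= Om i i / k.
  rewrite real_normK ?num_real//; apply: le_trans co _.
  rewrite ler_wpM2l ?(ltW (posdef_diag_gt0 Om_posdef _))//.
  by rewrite -[k^-1]mulr1 ler_pdivlMl// ltW.
have := normr_ge0 (z S 0 i); have := Oge0 i; nra.
Qed.

(** The gradient of Q is 2 z Om^-1, which the factor [Om] in [G] turns back into 2 z; so this part
    equals -2 [dcutoff_gauss] times the drift. The Gaussian half of the derivative yields the drift
    of the operator, the cut-off half the term with 4 k. *)
Let sum_dF S : \sum_a dF a S =
  (pos_part (1 - k * Q S) ^+ 2 * (drift S + trace2 S)
   + 4 * k * pos_part (1 - k * Q S) * drift S) * expR (- Q S / 2).
Proof.
rewrite big_split /=.
have -> : \sum_a G S a * (dcutoff_gauss k (Q S) * (2 * (z S *m invmx Om) 0 a)) =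
    - 2 * dcutoff_gauss k (Q S) * drift S.
  have -> : - 2 * dcutoff_gauss k (Q S) * drift S =
      2 * dcutoff_gauss k (Q S) * \sum_b z S 0 b * 'd f S (e b).
    by rewrite drift_coords; ring.
  have Omu := posdef_unitmx Om_posdef.
  have zE b : z S 0 b = \sum_a (z S *m invmx Om) 0 a * Om a b.
    by rewrite -{1}(mulmxKV Omu (z S)) mxE.
  rewrite mulr_sumr; under [RHS]eq_bigr do rewrite zE mulr_suml mulr_sumr.
  rewrite exchange_big; apply: eq_bigr => a _ /=.
  rewrite mulr_suml; apply: eq_bigr => b _; ring.
have -> : \sum_a cutoff_gauss k (Q S) * dG S a = cutoff_gauss k (Q S) * trace2 S.
  (* The arguments of [D2] come in the opposite order; this is settled by renaming indices and the
     symmetry of [Om], not by a symmetry of [D2]. *)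
  rewrite -mulr_sumr; congr (_ * _); rewrite [RHS]exchange_big.
  apply: eq_bigr => a _; apply: eq_bigr => b _.
  by rewrite -[in LHS]Om_sym mxE.
by rewrite /dcutoff_gauss /cutoff_gauss; field.
Qed.

Lemma truncated_stein_lebesgue :
  let t S := (pos_part (1 - k * Q S) ^+ 2 * (drift S + trace2 S)
   + 4 * k * pos_part (1 - k * Q S) * drift S) * expR (- Q S / 2) in
  leb.-integrable setT (EFin \o (t \o st)) /\ (\int[leb]_y (t (st y))%:E = 0)%E.
Proof.
move=> t.
have [h1 h2] := integral_sum_eq0 (index_enum 'I_n) (fun a =>
  @integral_directional_derive_eq0 _ _ _ e x coord_of_coords a (F a) (dF a) K
    (is_derive_F a) (@dF_continuous a) (@F_support a)).
have tE y : \sum_a dF a (st y) = t (st y) by exact: sum_dF.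
split; last by under eq_integral do rewrite -tE.
by congr (_.-integrable _ _): h1; apply/funext => y /=; rewrite tE.
Qed.


Lemma drift_trace2_integrand_continuous : continuous (fun S =>
  pos_part (1 - k * Q S) ^+ 2 * (drift S + trace2 S)
   + 4 * k * pos_part (1 - k * Q S) * drift S).
Proof.
have cp : continuous (fun S => pos_part (1 - k * Q S)).
  move=> S; apply: continuous_cvg; first exact: continuous_pos_part.
  by apply: cvgB; [exact: cvg_cst|apply: cvgMl_tmp; exact: mahalanobis_continuous].
move=> S; apply: cvgD; apply: cvgM.
- by apply: cvgM; exact: cp.
- by apply: cvgD; [exact: drift_continuous|exact: trace2_continuous].
- by apply: cvgMl_tmp; exact: cp.
- exact: drift_continuous.
Qed.

Context (dT : measure_display) (T : measurableType dT) (P : probability T R).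
Variable Y : T -> tupR.
Hypothesis mY : measurable_fun setT Y.
Hypothesis hY : has_law_mvn P Y [tuple x a M | a < n] Om.

(** The factor exp(-Q/2) is the density up to the constant [c], which factors out of an integral
    equal to 0. *)
Lemma truncated_stein_law :
  let t S := pos_part (1 - k * Q S) ^+ 2 * (drift S + trace2 S)
   + 4 * k * pos_part (1 - k * Q S) * drift S in
  P.-integrable setT (fun w => (t (st (Y w)))%:E) /\
  (\int[P]_w (t (st (Y w)))%:E = 0)%E.
Proof.
move=> t.
have mt : measurable_fun setT (t \o st).
  by apply: measurable_comp_lincomb; exact: drift_trace2_integrand_continuous.
have [h1 h2] := truncated_stein_lebesgue.
have pdfE y : mvn_pdf [tuple x a M | a < n] Om y =
    (Num.sqrt ((2 * pi) ^+ n * \det Om))^-1 * expR (- Q (st y) / 2).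
  have zE : \row_a (tnth y a - tnth [tuple x a M | a < n] a) = centered (st y).
    by apply/rowP => a; rewrite !mxE coord_of_coords tnth_mktuple.
  by rewrite /mvn_pdf zE.
set c := (Num.sqrt _)^-1 in pdfE.
have E y : (t (st y) * mvn_pdf [tuple x a M | a < n] Om y)%:E =
    (c%:E * (t (st y) * expR (- Q (st y) / 2))%:E)%E.
  by rewrite pdfE -EFinM; congr EFin; ring.
split.
  apply/(integrable_mvnP mY hY mt).
  rewrite (_ : (fun y => _) = (fun y => c%:E * (t (st y) * expR (- Q (st y) / 2))%:E)%E).
    exact: integrableZl.
  by apply/funext => y; exact: E.
rewrite (expectation_mvn mY hY mt) (eq_integral _ _ (fun y _ => E y)).
by rewrite integralZl// h2 mule0.
Qed.

End Divergence.

(** * Removal of the cut-off *)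

Lemma cvg_pos_part_mahalanobis S :
  pos_part (1 - j.+1%:R^-1 * Q S) @[j --> \oo] --> (1 : R).
Proof.
have E : pos_part (1 - 0 * Q S) = 1 by rewrite mul0r subr0 pos_part_id.
rewrite -[X in _ --> X]E.
apply: continuous_cvg; first exact: continuous_pos_part.
apply: cvgB; first exact: cvg_cst.
by apply: cvgMr_tmp; exact: cvg_harmonic.
Qed.

Lemma pos_part_mahalanobis_le1 (k : R) S : 0 < k ->
  0 <= pos_part (1 - k * Q S) <= 1.
Proof.
move=> k0; rewrite pos_part_ge0 /pos_part ge_max ler01 /= gerBl.
by rewrite mulr_ge0 ?mahalanobis_ge0// ltW.
Qed.

Section SteinLaw.
Variable f : V -> R.
Hypothesis C2f : C2 f.
Context (dT : measure_display) (T : measurableType dT) (P : probability T R).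
Variable Y : T -> tupR.
Hypothesis mY : measurable_fun setT Y.
Hypothesis hY : has_law_mvn P Y [tuple x a M | a < n] Om.

Let measurable_comp g : continuous g -> measurable_fun setT (fun w => g (st (Y w)) : R).
Proof.
by move=> /measurable_comp_lincomb mg; exact: (measurableT_comp (mg _ _) mY).
Qed.

Lemma stein_law :
  P.-integrable setT (fun w => (drift f (st (Y w)))%:E) ->
  P.-integrable setT (fun w => (trace2 f (st (Y w)))%:E) ->
  P.-integrable setT (fun w => (drift f (st (Y w)) + trace2 f (st (Y w)))%:E) /\
  (\int[P]_w (drift f (st (Y w)) + trace2 f (st (Y w)))%:E = 0)%E.
Proof.
move=> Id It.
pose t j S := pos_part (1 - j.+1%:R^-1 * Q S) ^+ 2 * (drift f S + trace2 f S)
   + 4 * j.+1%:R^-1 * pos_part (1 - j.+1%:R^-1 * Q S) * drift f S.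
have k0 j : 0 < j.+1%:R^-1 :> R by rewrite invr_gt0.
have tl j := truncated_stein_law C2f (k0 j) mY hY.
(* The coefficient 5 is 1 from the squared cut-off plus 4 from the boundary term, as k = 1/(j+1) and
   the cut-off are at most 1. *)
have [||||I lim] := @dominated_cvg_integral _ _ _ P (fun j w => t j (st (Y w)))
  (fun w => drift f (st (Y w)) + trace2 f (st (Y w)))
  (fun w => 5 * `|drift f (st (Y w))| + `|trace2 f (st (Y w))|).
- move=> j; apply: measurable_comp.
  exact: drift_trace2_integrand_continuous.
- move=> w; set S := st (Y w).
  have cp := @cvg_pos_part_mahalanobis S.
  have -> : drift f S + trace2 f S =
    1 ^+ 2 * (drift f S + trace2 f S) + 4 * 0 * 1 * drift f S by ring.
  apply: cvgD; apply: cvgMr_tmp; first by apply: cvgM; exact: cp.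
  by apply: cvgM => //; apply: cvgMl_tmp; exact: cvg_harmonic.
- move=> j w; set S := st (Y w).
  have /andP[p0 p1] := pos_part_mahalanobis_le1 S (k0 j).
  have j1 : j.+1%:R^-1 <= 1 :> R by rewrite invf_le1// ler1n.
  rewrite /t; set p := pos_part _ in p0 p1 *; set u := j.+1%:R^-1 in j1 *.
  have u0 : 0 < u by exact: k0.
  have p2 : p ^+ 2 <= 1 by rewrite expr_le1.
  apply: le_trans (ler_normD _ _) _.
  have -> : `|p ^+ 2 * (drift f S + trace2 f S)| = p ^+ 2 * `|drift f S + trace2 f S|.
    by rewrite normrM [`|p ^+ 2|]ger0_norm// sqr_ge0.
  have -> : `|4 * u * p * drift f S| = 4 * u * p * `|drift f S|.
    by rewrite normrM [`|4 * u * p|]ger0_norm// !mulr_ge0// ltW.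
  have h1 : p ^+ 2 * `|drift f S + trace2 f S| <= `|drift f S| + `|trace2 f S|.
    by apply: le_trans (ler_normD _ _); rewrite ler_piMl.
  have h2 : 4 * u * p * `|drift f S| <= 4 * `|drift f S|.
    rewrite ler_wpM2r// -mulrA ler_piMr// mulr_ile1// ltW//.
  lra.
- apply: (@eq_integrable _ _ _ _ _ measurableT ((fun w => 5%:E * `|drift f (st (Y w))|%:E)
    \+ (fun w => `|trace2 f (st (Y w))|%:E))%E).
    by [].
  apply: integrableD => //; last exact: integrable_norm.
  by apply: integrableZl => //; exact: integrable_norm.
split => //; rewrite -(cvg_lim _ lim)//.
rewrite (_ : (fun j => _) = cst 0%E); first exact: lim_cst.
by apply/funext => j; exact: (tl j).2.
Qed.

(* In the truncated identity the boundary term has the sign of the drift, so it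
   can be dropped. *)
Lemma integrable_drift_le0 (B : R) :
  (forall S, drift f S <= 0) -> (forall S, `|trace2 f S| <= B) ->
  P.-integrable setT (fun w => (drift f (st (Y w)))%:E).
Proof.
move=> dle0 tB.
have k0 j : 0 < j.+1%:R^-1 :> R by rewrite invr_gt0.
pose p j w := pos_part (1 - j.+1%:R^-1 * Q (st (Y w))).
have cp j : continuous (fun S => pos_part (1 - j.+1%:R^-1 * Q S)).
  move=> S; apply: continuous_cvg; first exact: continuous_pos_part.
  by apply: cvgB; [exact: cvg_cst|apply: cvgMl_tmp; exact: mahalanobis_continuous].
have mp j : measurable_fun setT (p j).
  by apply: (measurable_comp (g := fun S => pos_part (1 - j.+1%:R^-1 * Q S))).
have md : measurable_fun setT (fun w => drift f (st (Y w))).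
  by apply: measurable_comp; exact: drift_continuous.
have mt : measurable_fun setT (fun w => trace2 f (st (Y w))).
  by apply: measurable_comp; exact: trace2_continuous.
have p01 j w : 0 <= p j w <= 1 by exact: pos_part_mahalanobis_le1.
pose g j w := p j w ^+ 2 * - drift f (st (Y w)).
have gB j : (\int[P]_w (g j w)%:E <= B%:E)%E.
  have [I1 I2] := truncated_stein_law C2f (k0 j) mY hY.
  have p2t w : `|p j w ^+ 2 * trace2 f (st (Y w))| <= B.
    have /andP[p0 p1] := p01 j w.
    rewrite normrM ger0_norm ?sqr_ge0//; apply: le_trans (tB (st (Y w))).
    by rewrite ler_piMl// expr_le1.
  have mpt : measurable_fun setT (fun w => p j w ^+ 2 * trace2 f (st (Y w))).
    by apply: measurable_funM => //; apply: measurable_funX.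
  have It := bounded_integrable P mpt p2t.
  (* The truncated identity with the drift moved to the other side. Integrability there is that of
     the bounded second-order term minus the integrable truncated expression, so none is presupposed
     for the drift. *)
  have E0 : (\int[P]_w (p j w ^+ 2 * trace2 f (st (Y w)))%:E =
     \int[P]_w ((p j w ^+ 2 + 4 * j.+1%:R^-1 * p j w) * - drift f (st (Y w)))%:E)%E.
    rewrite -[RHS]add0e -I2 -integralD//.
      by apply: eq_integral => w _; rewrite -EFinD; congr EFin; rewrite /p; ring.
    rewrite (_ : (fun w => _) = ((fun w => (p j w ^+ 2 * trace2 f (st (Y w)))%:E) \-
      (fun w => (p j w ^+ 2 * (drift f (st (Y w)) + trace2 f (st (Y w)))
       + 4 * j.+1%:R^-1 * p j w * drift f (st (Y w)))%:E))%E).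
      exact: integrableB.
    by apply/funext => w; rewrite /= -EFinB; congr EFin; ring.
  apply: (@le_trans _ _ (\int[P]_w (p j w ^+ 2 * trace2 f (st (Y w)))%:E)%E).
    rewrite E0; apply: ge0_le_integral => //=.
    + by move=> w _; rewrite lee_fin mulr_ge0 ?sqr_ge0 ?oppr_ge0.
    + apply/measurable_EFinP; apply: measurable_funM; first exact: measurable_funX.
      exact: measurableT_comp.
    + apply/measurable_EFinP; apply: measurable_funM; last exact: measurableT_comp.
      by apply: measurable_funD; [exact: measurable_funX|exact: measurable_funM].
    + move=> w _; rewrite lee_fin ler_wpM2r ?oppr_ge0// lerDl.
      by have /andP[p0 _] := p01 j w; rewrite !mulr_ge0// ltW.
  rewrite -[leRHS](_ : (\int[P]_w B%:E = B%:E)%E); last first.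
    by rewrite integral_cst//= probability_setT mule1.
  apply: le_integral => //.
    exact: finite_measure_integrable_cst.
  by move=> w _; rewrite lee_fin (le_trans (ler_norm _)).
apply/integrableP; split; first exact/measurable_EFinP.
rewrite (eq_integral (fun w => limn (fun j => (g j w)%:E))); last first.
  move=> w _; apply/esym/cvg_lim => //.
  rewrite /= ler0_norm//; apply: cvg_EFin; first exact: nearW.
  rewrite -[X in _ --> X]mul1r; apply: cvgMr_tmp.
  by rewrite -[X in _ --> X](expr1n _ 2); apply: cvgM; exact: cvg_pos_part_mahalanobis.
have mg j : measurable_fun setT (EFin \o g j).
  apply/measurable_EFinP; apply: measurable_funM; first exact: measurable_funX.
  exact: measurableT_comp.
have g0 j w : (0 <= (g j w)%:E)%E by rewrite lee_fin mulr_ge0 ?sqr_ge0 ?oppr_ge0.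
(* As Q >= 0, the cut-off increases when k = 1/(j+1) decreases, so monotone convergence carries the
   bound B over to the full drift. *)
have ndg w i j : (i <= j)%N -> ((g i w)%:E <= (g j w)%:E)%E.
  move=> ij; rewrite lee_fin ler_wpM2r ?oppr_ge0//.
  have /andP[pi0 _] := p01 i w; have /andP[pj0 _] := p01 j w.
  rewrite ler_sqr// /p /pos_part.
  apply: le_max2; rewrite ?lexx// lerD2l lerN2 ler_wpM2r ?mahalanobis_ge0//.
  by rewrite lef_pV2 ?posrE// ler_nat.
rewrite monotone_convergence//; last by move=> w _ i j; exact: ndg.
apply: le_lt_trans (ltry B); apply: lime_le; last by apply: nearW => j; exact: gB.
apply/ereal_nondecreasing_is_cvgn => i j ij; apply: ge0_le_integral => //.
- exact: mg.
- exact: mg.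
- by move=> w _; exact: ndg.
Qed.

End SteinLaw.

End TruncatedStein.

(** * Functions of one linear form *)

Section RidgeFunctions.
Variables (R : realType) (V : normedModType R) (lam : {linear V -> R}).
Hypothesis lam_cont : continuous lam.
Variables (h h1 h2 : R -> R).
Hypothesis dh : forall t, is_derive t (1 : R) h (h1 t).
Hypothesis dh1 : forall t, is_derive t (1 : R) h1 (h2 t).
Hypothesis ch2 : continuous h2.
Local Notation f := (h \o lam).

Lemma ridge_diff (g g1 : R -> R) S :
  (forall t, is_derive t (1 : R) g (g1 t)) ->
  differentiable (g \o lam) S /\ forall U, 'd (g \o lam) S U = g1 (lam S) * lam U.
Proof.
move=> dg.
have dl : differentiable lam S by exact: linear_differentiable.
have dgl : differentiable g (lam S) by apply/derivable1_diffP; exact: ex_derive.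
split; first exact: differentiable_comp.
move=> U; rewrite diff_comp//= diff_lin//.
rewrite diff1E// derive1E (@derive_val _ _ _ _ _ _ _ (dg (lam S))).
by rewrite /GRing.scale /= mulrC.
Qed.

Lemma ridge_D1 S U : 'd f S U = h1 (lam S) * lam U.
Proof. exact: (ridge_diff S dh).2. Qed.

Lemma ridge_D2 S U W : D2 f S U W = h2 (lam S) * lam U * lam W.
Proof.
rewrite /D2 (_ : (fun T => _) = (fun t => h1 t * lam U) \o lam); last first.
  by apply/funext => T; rewrite /= ridge_D1.
have dg t : is_derive t (1 : R) (fun t => h1 t * lam U) (h2 t * lam U).
  apply: (is_derive_eq (is_deriveM (dh1 t) (is_derive_cst (lam U) t (1 : R)))).
  by rewrite scaler0 add0r /GRing.scale /= mulrC.
by rewrite (ridge_diff S dg).2.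
Qed.

(** Each of the two increments enters through [lam], which costs a Lipschitz constant [L]; hence the
    one-dimensional estimates for [h1] and [h2] are used with eps / L^2. *)
Lemma ridge_C2 : C2 f.
Proof.
have [L L0 lamL] := linear_lipschitz lam_cont.
have lamL' U : `|lam U| <= L * `|U| by exact: lamL.
split=> [S|S eps eps0|S eps eps0].
- exact: (ridge_diff S dh).1.
- have e0 : 0 < eps / L ^+ 2 by rewrite divr_gt0// exprn_gt0.
  have h1S : \forall d \near (0 : R),
      `|h1 (lam S + d) - h1 (lam S) - h2 (lam S) * d| <= eps / L ^+ 2 * `|d|.
    have [dd dv] := dh1 (lam S).
    have : (fun d : R => d^-1 *: ((h1 \o shift (lam S)) (d *: 1) - h1 (lam S))) @ 0^'
        --> h2 (lam S) by rewrite -dv; exact: dd.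
    move/cvgrPdist_le => /(_ _ e0) near0; have {}near0 : \forall d \near (0 : R), d != 0 ->
        `|h2 (lam S) - d^-1 * (h1 (d * 1 + lam S) - h1 (lam S))| <= eps / L ^+ 2.
      exact: near0.
    apply: filterS near0 => d hd; have [->|d0] := eqVneq d 0.
      by rewrite addr0 subrr mulr0 subrr normr0 mulr0.
    have {hd} := hd d0; rewrite mulr1 [d + _]addrC => hd.
    rewrite [X in `|X|](_ : _ = - (h2 (lam S) - d^-1 * (h1 (lam S + d) - h1 (lam S))) * d).
      by rewrite normrM normrN ler_wpM2r.
    by field.
  have lam0 : lam H @[H --> 0] --> (0 : R) by rewrite -(linear0 lam); exact: lam_cont.
  have near0 : \forall H \near (0 : V), `|h1 (lam S + lam H) - h1 (lam S) -
      h2 (lam S) * lam H| <= eps / L ^+ 2 * `|lam H| by exact: lam0 h1S.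
  apply: filterS near0 => H hH U.
  rewrite !ridge_D1 ridge_D2 linearD.
  have -> : h1 (lam S + lam H) * lam U - h1 (lam S) * lam U - h2 (lam S) * lam U * lam H
    = (h1 (lam S + lam H) - h1 (lam S) - h2 (lam S) * lam H) * lam U by ring.
  rewrite normrM; apply: (@le_trans _ _ (eps / L ^+ 2 * (L * `|H|) * (L * `|U|))).
    apply: ler_pM => //; apply: le_trans hH _.
    by rewrite ler_wpM2l// ltW.
  by rewrite le_eqVlt; apply/orP; left; apply/eqP; field; rewrite gt_eqF.
- have e0 : 0 < eps / L ^+ 2 by rewrite divr_gt0// exprn_gt0.
  have c2 : continuous (h2 \o lam).
    by move=> T; apply: continuous_comp; [exact: lam_cont|exact: ch2].
  have /cvgrPdist_le/(_ _ e0) := c2 S; apply: filterS => T /= hT U W.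
  rewrite !ridge_D2 -!mulrBl !normrM.
  apply: (@le_trans _ _ (eps / L ^+ 2 * (L * `|U|) * (L * `|W|))).
    by rewrite !ler_pM ?mulr_ge0// distrC.
  by rewrite le_eqVlt; apply/orP; left; apply/eqP; field; rewrite gt_eqF.
Qed.

End RidgeFunctions.

(** * The differential equation for the cosine expectations *)

Section CosOfStein.
Context d (T : measurableType d) (R : realType) (P : probability T R).
Variables (U : T -> R) (kap : R).
Hypothesis mU : measurable_fun setT U.
Let g a b w := a * U w * sin (a * U w + b) - a ^+ 2 * kap * cos (a * U w + b).
Hypothesis steinU : forall a b,
  P.-integrable setT (fun w => (g a b w)%:E) /\ (\int[P]_w (g a b w)%:E = 0)%E.

Let mlin a b : measurable_fun setT (fun w => a * U w + b).
Proof. by apply: measurable_funD => //; exact: measurable_funM. Qed.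

Let mcos a b : measurable_fun setT (fun w => cos (a * U w + b)).
Proof.
apply: measurableT_comp => //.
by apply: continuous_measurable_fun; exact: continuous_cos.
Qed.

Let cos_le1' (t : R) : `|cos t| <= 1. Proof. by rewrite ler_norml cos_geN1 cos_le1. Qed.
Let sin_le1' (t : R) : `|sin t| <= 1. Proof. by rewrite ler_norml sin_geN1 sin_le1. Qed.

Let integrable_cos a b : P.-integrable setT (fun w => (cos (a * U w + b))%:E).
Proof. by apply: (@bounded_integrable _ _ _ P _ 1 (mcos a b)) => w. Qed.

Let integrable_U_sin a b : P.-integrable setT (fun w => (a * U w * sin (a * U w + b))%:E).
Proof.
have [I _] := steinU a b.
rewrite (_ : (fun w => _) = ((fun w => (g a b w)%:E) \+
    (fun w => (a ^+ 2 * kap)%:E * (cos (a * U w + b))%:E))%E).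
  by apply: integrableD => //; exact: integrableZl.
by apply/funext => w; rewrite /= -EFinM -EFinD /g subrK.
Qed.

(** The phases 0 and pi/2 give U sin U and U cos U, and |sin u| + |cos u| >= 1 because sin^2 + cos^2
    = 1 with both absolute values at most 1. *)
Let integrable_U : P.-integrable setT (EFin \o U).
Proof.
have I1 := integrable_U_sin 1 0; have I2 := integrable_U_sin 1 (pi / 2).
apply: (@le_integrable _ _ _ _ _ measurableT _
  (fun w => `|(1 * U w * sin (1 * U w + 0))%:E| + `|(1 * U w * sin (1 * U w + pi / 2))%:E|)%E).
- exact/measurable_EFinP.
- move=> w _ /=; rewrite lee_fin; set u := U w.
  rewrite !mul1r addr0 sinDpihalf !normrM -mulrDr.
  rewrite [leRHS]ger0_norm ?mulr_ge0 ?addr_ge0//.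
  rewrite ler_peMr//.
  have := cos2Dsin2 u.
  rewrite -(real_normK (num_real (cos u))) -(real_normK (num_real (sin u))).
  have := cos_le1' u; have := sin_le1' u.
  have := normr_ge0 (cos u); have := normr_ge0 (sin u); nra.
- by apply: integrableD => //; exact: integrable_abse.
Qed.

Let F b a := (\int[P]_w cos (a * U w + b))%R.

Let FE b a : (\int[P]_w (cos (a * U w + b))%:E = (F b a)%:E)%E.
Proof.
rewrite /F /Rintegral fineK//.
by apply: integrable_fin_num => //; exact: integrable_cos.
Qed.

Let is_derive_cosU (b : R) w (a : R) :
  is_derive a (1 : R) (fun a : R => cos (a * U w + b)) (- U w * sin (a * U w + b)).
Proof.
have d1 : is_derive a (1 : R) (fun a : R => a * U w + b) (U w).
  apply: (is_derive_eq (is_deriveD (is_deriveM (is_derive_id a (1 : R))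
    (is_derive_cst (U w) a (1 : R))) (is_derive_cst b a (1 : R)))).
  by rewrite /GRing.scale /=; ring.
apply: (is_derive_eq (is_derive1_comp (is_derive_cos _) d1)).
by rewrite /=; ring.
Qed.

(** |U| dominates the derivatives for all a. The open interval contains [0, 1] together with its
    endpoints. *)
Let is_derive_F (b a : R) : a \in `]-1, 2[ ->
  is_derive a (1 : R) (F b) (\int[P]_w (- U w * sin (a * U w + b)))%R.
Proof.
move=> aI.
have E : (\int[P]_w partial1of2 (fun (a : R) w => cos (a * U w + b)) a w)%R =
    (\int[P]_w (- U w * sin (a * U w + b)))%R.
  congr Rintegral; apply/funext => w; rewrite partial1of2E.
  exact: (@derive_val _ _ _ _ _ _ _ (is_derive_cosU b w a)).
have intf (a' : R) : (`]-1, 2[%classic : set R) a' ->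
    P.-integrable setT (EFin \o (fun w => cos (a' * U w + b))).
  by move=> _; exact: integrable_cos.
have der (a' : R) w : (`]-1, 2[%classic : set R) a' -> setT w ->
    derivable (fun a : R => cos (a * U w + b)) a' 1.
  by move=> _ _; have h := is_derive_cosU b w a'; exact: ex_derive.
have ub (a' : R) w : (`]-1, 2[%classic : set R) a' -> setT w ->
    `|partial1of2 (fun (a : R) w => cos (a * U w + b)) a' w| <= `|U w|.
  move=> _ _; rewrite partial1of2E (@derive_val _ _ _ _ _ _ _ (is_derive_cosU b w a')).
  by rewrite normrM normrN ler_piMr.
have IG : P.-integrable setT (EFin \o (fun w => `|U w|)).
  exact: integrable_norm integrable_U.
have D1 := @derivable_under_integral R d T P _ setT measurableT a (-1) 2 aI intf der _
  (fun w => normr_ge0 (U w)) IG ub.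
have D2 := @differentiation_under_integral R d T P _ setT measurableT a (-1) 2 aI intf der _
  (fun w => normr_ge0 (U w)) IG ub.
by apply: DeriveDef => //; rewrite -derive1E D2 E.
Qed.

(** The Stein identity for cos(a U + b), divided by -a. *)
Let dF_eq (b a : R) : 0 < a -> (\int[P]_w (- U w * sin (a * U w + b)))%R = - a * kap * F b a.
Proof.
move=> a0; have [_ z0] := steinU a b.
have I1 := integrable_U_sin a b; have I2 := integrable_cos a b.
have I3 : P.-integrable setT (EFin \o (fun w => - U w * sin (a * U w + b))).
  rewrite (_ : _ \o _ = (fun w => (- a^-1)%:E * (a * U w * sin (a * U w + b))%:E)%E).
    exact: integrableZl.
  by apply/funext => w; rewrite /= -EFinM; congr EFin; field; rewrite gt_eqF.
have I4 : P.-integrable setT (EFin \o (fun w => - a * (- U w * sin (a * U w + b)))).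
  exact: (integrableZl measurableT (- a) I3).
have I5 : P.-integrable setT (EFin \o (fun w => a ^+ 2 * kap * cos (a * U w + b))).
  exact: (integrableZl measurableT (a ^+ 2 * kap) I2).
have : (\int[P]_w (g a b w) = 0)%R by rewrite /Rintegral z0.
rewrite (_ : g a b = (fun w => - a * (- U w * sin (a * U w + b)) -
    a ^+ 2 * kap * cos (a * U w + b))); last by apply/funext => w; rewrite /g; ring.
rewrite RintegralB// RintegralZl// RintegralZl// -/(F b a) => h.
have a0' : - a != 0 by rewrite oppr_eq0 gt_eqF.
by apply: (mulfI a0'); move: h => /eqP; rewrite subr_eq0 => /eqP ->; ring.
Qed.

Lemma cos_of_stein b :
  (\int[P]_w (cos (U w + b))%:E = (expR (- kap / 2) * cos b)%:E)%E.
Proof.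
(* The solution multiplied by the integrating factor of y' = - a kap y; it is constant on [0, 1],
   and its values at 0 and 1 give the claim. *)
pose psi (a : R) := expR (kap / 2 * a ^+ 2) * F b a.
have dpsi (a : R) : a \in `]0, 1[ -> is_derive a (1 : R) psi 0.
  rewrite in_itv /= => /andP[a0 a1].
  have dFa : is_derive a (1 : R) (F b) (- a * kap * F b a).
    rewrite -dF_eq//; apply: is_derive_F; rewrite in_itv /=; apply/andP; split; lra.
  have d1 : is_derive a (1 : R) (fun a : R => kap / 2 * a ^+ 2) (kap * a).
    apply: (is_derive_eq (is_deriveZ (kap / 2) (is_deriveX 2 (is_derive_id a (1 : R))))).
    by rewrite /GRing.scale /= expr1; field.
  apply: (is_derive_eq (is_deriveM (is_derive1_comp (is_derive_expR _) d1) dFa)).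
  by rewrite /GRing.scale /=; ring.
(* The differential equation was obtained for a > 0 only; at the endpoints the mean value theorem
   asks just for continuity. *)
have cpsi : {within `[0, 1], continuous psi}.
  apply: derivable_within_continuous => a; rewrite in_itv /= => /andP[a0 a1].
  apply: derivableM.
    by apply/derivable1_diffP; apply: differentiable_comp => //; apply/derivable1_diffP.
  have h : is_derive a (1 : R) (F b) _ := is_derive_F b _; apply: ex_derive; apply: h.
  by rewrite in_itv /=; apply/andP; split; lra.
have [c _] := MVT ltr01 dpsi cpsi; rewrite mul0r => /eqP; rewrite subr_eq0 => /eqP.
rewrite /psi expr1n mulr1 expr0n /= mulr0 expR0 mul1r => E.
have F0 : F b 0 = cos b.
  apply: EFin_inj; rewrite -FE; under eq_integral do rewrite mul0r add0r.
  by rewrite integral_cst//= probability_setT mule1.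
have -> : (\int[P]_w (cos (U w + b))%:E = (F b 1)%:E)%E.
  by rewrite -FE; under [RHS]eq_integral do rewrite mul1r.
by rewrite -F0 -E mulrA -expRD mulNr addNr expR0 mul1r.
Qed.

End CosOfStein.

(** * The Stein identities determine the law *)

Section SteinCharacterization.
Variables (R : realType) (V : normedModType R) (n : nat).
Variables (e : 'I_n -> V) (x : 'I_n -> V -> R).
Hypothesis x_cont : forall a, continuous (x a).
Hypothesis xD : forall a S T, x a (S + T) = x a S + x a T.
Hypothesis xZ : forall a c S, x a (c *: S) = c * x a S.
Hypothesis xe : forall a b, x b (e a) = (b == a)%:R.
Hypothesis xE : forall S, S = \sum_a x a S *: e a.
Variables (Om : 'M[R]_n) (M : V).
Hypothesis Om_sym : Om^T = Om.
Hypothesis Om_posdef : forall v : 'rV_n, v != 0 -> 0 < (v *m Om *m v^T) 0 0.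
Local Notation tupR := (n.-tuple (measurableTypeR R)).
Local Notation st := (of_coords e).

Lemma exists_linear_form (t : 'I_n -> R) : exists lam : {linear V -> R},
  [/\ continuous lam, forall a, lam (e a) = t a &
      forall y : tupR, lam (st y) = \sum_a t a * tnth y a].
Proof.
pose l S := \sum_a t a * x a S.
have linl : linear l.
  move=> c S T; rewrite /l scaler_sumr -big_split; apply: eq_bigr => a _ /=.
  by rewrite xD xZ /GRing.scale /=; ring.
pose lam : {linear V -> R} := HB.pack l (GRing.isLinear.Build R V R _ l linl).
exists lam; split.
- move=> S; apply: cvg_big => [|a _]; first exact: add_continuous.
  by apply: cvgMl_tmp; exact: x_cont.
- move=> a; rewrite /= /l (bigD1 a)//= big1 => [|b ba]; rewrite xe; last first.
    by rewrite (negbTE ba) mulr0.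
  by rewrite eqxx mulr1 addr0.
- by move=> y; apply: eq_bigr => a _; rewrite (coord_of_coords xD xZ xe).
Qed.

Section Ridge.
Variable lam : {linear V -> R}.
Hypothesis lam_cont : continuous lam.
Variables (h h1 h2 : R -> R).
Hypothesis dh : forall t, is_derive t (1 : R) h (h1 t).
Hypothesis dh1 : forall t, is_derive t (1 : R) h1 (h2 t).

Lemma drift_ridge S : drift M (h \o lam) S = h1 (lam S) * (lam M - lam S).
Proof. by rewrite /drift (ridge_D1 lam_cont dh) linearB. Qed.

Lemma trace2_ridge S : trace2 e Om (h \o lam) S =
  h2 (lam S) * \sum_a \sum_b Om a b * lam (e a) * lam (e b).
Proof.
rewrite /trace2 mulr_sumr; apply: eq_bigr => a _; rewrite mulr_sumr.
by apply: eq_bigr => b _; rewrite (ridge_D2 lam_cont dh dh1); ring.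
Qed.

End Ridge.

Context (dZ dX : measure_display) (TZ : measurableType dZ) (TX : measurableType dX).
Variables (PZ : probability TZ R) (PX : probability TX R).
Variables (YZ : TZ -> tupR) (YX : TX -> tupR).
Hypotheses (mYZ : measurable_fun setT YZ) (mYX : measurable_fun setT YX).
Hypothesis hYZ : has_law_mvn PZ YZ [tuple x a M | a < n] Om.

(* Uses the square of the centred form, whose drift is minus twice that square. *)
Let integrable_form (lam : {linear V -> R}) : continuous lam ->
  PZ.-integrable setT (fun w => (lam (st (YZ w)) - lam M)%:E).
Proof.
move=> cl; set m := lam M.
pose h s := (s - m) ^+ 2 : R.
have dh s : is_derive s (1 : R) h (2 * (s - m)).
  apply: (is_derive_eq (is_deriveX 2 (is_deriveB (is_derive_id s (1 : R))
    (is_derive_cst m s (1 : R))))).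
  by rewrite /GRing.scale /= expr1 subr0 mulr1.
have dh1 s : is_derive s (1 : R) (fun s => 2 * (s - m)) 2.
  apply: (is_derive_eq (is_deriveZ 2 (is_deriveB (is_derive_id s (1 : R))
    (is_derive_cst m s (1 : R))))).
  by rewrite /GRing.scale /=; ring.
have C2f : C2 (h \o lam) by apply: (ridge_C2 cl dh dh1) => s; exact: cvg_cst.
have dE S : drift M (h \o lam) S = - (2 * (lam S - m) ^+ 2).
  by rewrite (drift_ridge cl dh); ring.
(* The second derivative of a square is constant, so the second-order term is bounded by its own
   absolute value. *)
have I := integrable_drift_le0 x_cont xD xZ xe xE Om_sym Om_posdef C2f mYZ hYZ
  (B := `|2 * \sum_a \sum_b Om a b * lam (e a) * lam (e b)|).
have {}I : PZ.-integrable setT (fun w => (drift M (h \o lam) (st (YZ w)))%:E).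
  apply: I => S; first by rewrite dE oppr_le0 mulr_ge0// sqr_ge0.
  by rewrite (trace2_ridge cl dh dh1).
apply: (@le_integrable _ _ _ _ _ measurableT _
  ((EFin \o cst 1%R) \+ (fun w => `|(drift M (h \o lam) (st (YZ w)))%:E|))%E).
- apply/measurable_EFinP; apply: measurable_funB => //.
  exact: (measurableT_comp (measurable_comp_lincomb e cl) mYZ).
- move=> w _ /=; rewrite lee_fin dE; set u := _ - _.
  have u2 : 0 <= 2 * u ^+ 2 by rewrite mulr_ge0// sqr_ge0.
  have u3 : 0 <= 1 + 2 * u ^+ 2 by rewrite addr_ge0.
  rewrite normrN (ger0_norm u2) (ger0_norm u3).
  by rewrite ler_norml; apply/andP; split; nra.
- apply: integrableD => //; last exact: integrable_abse.
  exact: finite_measure_integrable_cst.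
Qed.

Lemma stein_characterizes_law :
  (forall f : V -> R, C2 f ->
    PZ.-integrable setT (fun w => (drift M f (st (YZ w)))%:E) ->
    PZ.-integrable setT (fun w => (trace2 e Om f (st (YZ w)))%:E) ->
    PX.-integrable setT (fun w => (drift M f (st (YX w)) + trace2 e Om f (st (YX w)))%:E) /\
    (\int[PX]_w (drift M f (st (YX w)) + trace2 e Om f (st (YX w)))%:E = 0)%E) ->
  forall A, measurable A -> PX (YX @^-1` A) = PZ (YZ @^-1` A).
Proof.
move=> HX; apply: trig_determines_law => // t c.
have [lam [cl le ly]] := exists_linear_form t.
set m := lam M; set kap := \sum_a \sum_b Om a b * lam (e a) * lam (e b).
pose h a b s : R := cos (a * (s - m) + b).
pose h1 a b s : R := - a * sin (a * (s - m) + b).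
pose h2 a b s : R := - a ^+ 2 * cos (a * (s - m) + b).
have dl a b s : is_derive s (1 : R) (fun s : R => a * (s - m) + b) a.
  apply: (is_derive_eq (is_deriveD (is_deriveZ a (is_deriveB (is_derive_id s (1 : R))
    (is_derive_cst m s (1 : R)))) (is_derive_cst b s (1 : R)))).
  by rewrite /GRing.scale /=; ring.
have dh a b s : is_derive s (1 : R) (h a b) (h1 a b s).
  apply: (is_derive_eq (is_derive1_comp (is_derive_cos _) (dl a b s))).
  by rewrite /h1; ring.
have dh1 a b s : is_derive s (1 : R) (h1 a b) (h2 a b s).
  apply: (is_derive_eq (is_deriveZ (- a) (is_derive1_comp (is_derive_sin _) (dl a b s)))).
  by rewrite /h2 /GRing.scale /=; ring.
have ch2 a b : continuous (h2 a b).
  move=> s; apply: cvgMl_tmp; apply: continuous_cvg; first exact: continuous_cos.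
  apply: cvgD; last exact: cvg_cst.
  by apply: cvgMl_tmp; apply: cvgB; [exact: cvg_id|exact: cvg_cst].
have C2f a b : C2 (h a b \o lam) by exact: (ridge_C2 cl (dh a b) (dh1 a b)).
have LE a b S : drift M (h a b \o lam) S + trace2 e Om (h a b \o lam) S =
    a * (lam S - m) * sin (a * (lam S - m) + b) -
    a ^+ 2 * kap * cos (a * (lam S - m) + b).
  rewrite (drift_ridge cl (dh a b)) (trace2_ridge cl (dh a b) (dh1 a b)).
  by rewrite /h1 /h2 -/kap -/m; ring.
have cont_comp g : continuous g -> measurable_fun setT (fun w => g (st (YZ w)) : R).
  by move=> cg; exact: (measurableT_comp (measurable_comp_lincomb e cg) mYZ).
(* The cosines lie in the class defined by Z: the drift is at most |a| times the centred form, which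
   is integrable, and the second-order term is bounded. *)
have Id a b : PZ.-integrable setT (fun w => (drift M (h a b \o lam) (st (YZ w)))%:E).
  apply: (@le_integrable _ _ _ _ _ measurableT _
    (fun w => a%:E * (lam (st (YZ w)) - lam M)%:E)%E).
  - apply/measurable_EFinP; apply: cont_comp.
    exact: (drift_continuous x_cont xD xZ xE).
  - move=> w _ /=; rewrite lee_fin (drift_ridge cl (dh a b)) /h1 -/m.
    rewrite -opprB mulrN normrN !normrM normrN ler_wpM2r//.
    by rewrite ler_piMr// ler_norml sin_geN1 sin_le1.
  - by apply: integrableZl => //; exact: integrable_form.
have It a b : PZ.-integrable setT (fun w => (trace2 e Om (h a b \o lam) (st (YZ w)))%:E).
  apply: (@bounded_integrable _ _ _ PZ _ (`|a ^+ 2 * kap|)).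
    by apply: cont_comp; exact: trace2_continuous.
  move=> w; rewrite (trace2_ridge cl (dh a b) (dh1 a b)) /h2 -/kap.
  rewrite mulrAC normrM mulNr normrN ler_piMr//.
  by rewrite ler_norml cos_geN1 cos_le1.
(* Stated for any probability space, since it serves X, by hypothesis, and Z, by [stein_law]. As
   cos(lam + c) = cos((lam - m) + (m + c)), the phase becomes m + c. *)
have val d (T : measurableType d) (P : probability T R) (Y : T -> tupR) :
    measurable_fun setT Y ->
    (forall a b, P.-integrable setT (fun w => (drift M (h a b \o lam) (st (Y w)) +
        trace2 e Om (h a b \o lam) (st (Y w)))%:E) /\
      (\int[P]_w (drift M (h a b \o lam) (st (Y w)) +
        trace2 e Om (h a b \o lam) (st (Y w)))%:E = 0)%E) ->
    (\int[P]_w (trig_mono t c (Y w))%:E = (expR (- kap / 2) * cos (m + c))%:E)%E.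
  move=> mY hP; rewrite -(@cos_of_stein _ _ _ P (fun w => lam (st (Y w)) - m)).
  - apply: eq_integral => w _; rewrite /trig_mono -ly; congr (cos _)%:E; ring.
  - apply: measurable_funB => //.
    exact: (measurableT_comp (measurable_comp_lincomb e cl) mY).
  - move=> a b; have [i1 i2] := hP a b; split.
      by under eq_fun do rewrite -LE.
    by under eq_integral do rewrite -LE.
rewrite (val _ _ _ _ mYX) ?(val _ _ _ _ mYZ)// => a b.
- exact: (stein_law x_cont xD xZ xe xE Om_sym Om_posdef (C2f a b) mYZ hYZ).
- exact: HX.
Qed.

End SteinCharacterization.

(** * Specialisation to symmetric matrices *)

Lemma lipschitz_form_continuous (R : realType) (V : normedModType R) (g : V -> R) (C : R) :
  0 <= C -> (forall S T, `|g S - g T| <= C * `|S - T|) -> continuous g.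
Proof.
move=> C_ge0 gC S; apply/cvgrPdist_le => /= eps eps0.
have C0 : 0 < C + 1 by rewrite ltr_wpDl.
have : \forall T \near S, `|S - T| <= eps / (C + 1).
  apply/nbhs_normP; exists (eps / (C + 1)); first by rewrite /= divr_gt0.
  by move=> T /= /ltW.
apply: filterS => T ST; apply: le_trans (gC S T) _.
apply: (@le_trans _ _ (C * (eps / (C + 1)))); first by rewrite ler_wpM2l.
by rewrite mulrA ler_pdivrMr// mulrDr mulr1 mulrC lerDl ltW.
Qed.

Lemma continuous_measurable_borel (R : realType) (d : nat) (g : symmx R d -> R) :
  continuous g -> measurable_fun setT g.
Proof.
move=> cg; apply: (measurability _ (RGenOpens.measurableE R)).
move=> _ [_ [u [v ->]] <-]; rewrite setTI.
by apply: sub_sigma_algebra; move/continuousP : cg; apply; exact: interval_open.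
Qed.

Section SymmetricCoordinates.
Variables (R : realType) (d : nat) (idx : 'I_(qdim d) -> 'I_d * 'I_d).
Hypothesis hidx : sym_ordering idx.
Variables M Psi Sigma : symmx R d.
Hypotheses (hPsi : posdef Psi) (hSigma : posdef Sigma).
Local Notation x := (fun a (S : symmx R d) => tnth (vecs idx S) a).
Local Notation E := (symE R idx).
Local Notation Om := (Omega idx Psi Sigma).
Local Notation st := (of_coords E).

Lemma vecs_lipschitz a (S : symmx R d) :
  `|x a S| <= Num.sqrt (frob_dot (E a) (E a)) * `|S|.
Proof.
rewrite /= -frob_symE -sqrtr_sqr -[`|S|]/(frob_norm S) /frob_norm.
rewrite -sqrtrM ?frob_dot_ge0// ler_sqrt ?mulr_ge0 ?frob_dot_ge0//.
exact: frob_CauchySchwarz.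
Qed.

Lemma vecs_continuous a : continuous (x a).
Proof.
apply: (@lipschitz_form_continuous _ _ _ _ (sqrtr_ge0 (frob_dot (E a) (E a)))) => S T.
have -> : x a S - x a T = x a (S - T).
  by rewrite /= vecsD -[in RHS]scaleN1r vecsZ mulN1r.
exact: vecs_lipschitz.
Qed.

Lemma of_coords_vecs (S : symmx R d) : st (vecs idx S) = S.
Proof. by rewrite [RHS](vecs_expansion hidx). Qed.

Lemma symE_coord a b : x b (E a) = (b == a)%:R.
Proof. exact: vecs_symE. Qed.

Lemma measurable_vecs dT (T : measurableType dT) (P : probability T R)
    (X : {RV P >-> symmx R d}) :
  measurable_fun setT (vecs idx \o X).
Proof.
apply/measurable_fun_tnthP => a.
apply: (measurableT_comp (f := x a)) => //.
by apply: continuous_measurable_borel; exact: vecs_continuous.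
Qed.

Lemma tr_driftE f S : tr_drift M f S = drift M f S.
Proof. by rewrite /tr_drift -gradP. Qed.

(** Expanding each D^2 f[V_ij, V_ij] in the basis [E] and summing over i, j first leaves the
    coefficients computed in [Vdir_Omega]. *)
Lemma tr_PsiSigmaE f S : C2 f -> tr_PsiSigma Psi Sigma f S = trace2 E Om f S.
Proof.
move=> C2f; rewrite /tr_PsiSigma /trace2.
have DE (V : symmx R d) : D2 f S V V =
    \sum_a \sum_b x a V * x b V * D2 f S (E a) (E b).
  exact: (D2_expansion (x := x) (vecs_expansion hidx) C2f).
under eq_bigr do under eq_bigr do rewrite DE.
under [RHS]eq_bigr do under eq_bigr do rewrite -(Vdir_Omega idx hPsi hSigma) -mulrA mulr_suml.
rewrite (eq_bigr (fun i => \sum_a \sum_b \sum_j x a (Vdir Psi Sigma i j) *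
    x b (Vdir Psi Sigma i j) * D2 f S (E a) (E b))); last first.
  move=> i _; rewrite exchange_big; apply: eq_bigr => a _ /=.
  by rewrite exchange_big.
rewrite exchange_big mulr_sumr; apply: eq_bigr => a _.
rewrite exchange_big mulr_sumr; apply: eq_bigr => b _ /=.
by congr (_ * _); apply: eq_bigr => i _; rewrite mulr_suml.
Qed.

End SymmetricCoordinates.

Section SymmetricNormalStein.
Variables (R : realType) (d : nat) (idx : 'I_(qdim d) -> 'I_d * 'I_d).
Hypothesis hidx : sym_ordering idx.
Variables M Psi Sigma : symmx R d.
Hypotheses (hPsi : posdef Psi) (hSigma : posdef Sigma).
Local Notation x := (fun a (S : symmx R d) => tnth (vecs idx S) a).
Local Notation E := (symE R idx).
Local Notation Om := (Omega idx Psi Sigma).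
Local Notation st := (of_coords E).
Context (dT : measure_display) (T : measurableType dT) (P : probability T R).
Variable X : {RV P >-> symmx R d}.

Lemma has_law_SN_mvn : has_law_SN idx X M Psi Sigma <->
  has_law_mvn P (vecs idx \o X) [tuple x a M | a < qdim d] Om.
Proof.
have mE : [tuple x a M | a < qdim d] = vecs idx M :> (qdim d).-tuple (measurableTypeR R).
  by apply: eq_from_tnth => a; rewrite tnth_mktuple.
by rewrite mE.
Qed.

Lemma measurable_drift f : C2 f -> measurable_fun setT (fun S => drift M f S).
Proof.
move=> C2f; apply: continuous_measurable_borel.
exact: (drift_continuous (vecs_continuous (idx := idx)) (@vecsD _ _ idx)
  (@vecsZ _ _ idx) (vecs_expansion hidx)).
Qed.

Lemma measurable_trace2 f : C2 f -> measurable_fun setT (fun S => trace2 E Om f S).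
Proof. by move=> C2f; apply: continuous_measurable_borel; exact: trace2_continuous. Qed.

(** For C^2 functions both expressions are continuous, hence Borel, so a finite absolute expectation
    amounts to integrability. *)
Lemma stein_classP f : C2 f ->
  stein_class X M Psi Sigma f <->
  P.-integrable setT (fun w => (drift M f (st (vecs idx (X w))))%:E) /\
  P.-integrable setT (fun w => (trace2 E Om f (st (vecs idx (X w))))%:E).
Proof.
move=> C2f; have mX : measurable_fun setT X by [].
have stE (g : symmx R d -> R) :
    (fun w => (g (st (vecs idx (X w))))%:E) = (fun w => (g (X w))%:E).
  by apply/funext => w; rewrite of_coords_vecs.
rewrite (stE (drift M f)) (stE (trace2 E Om f)).
have intE g : measurable_fun setT g ->
    P.-integrable setT (fun w => (g (X w))%:E) <->
    ('E_P[fun w => `|g (X w)|%R] < +oo)%E.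
  move=> mg; rewrite expectation.unlock; split=> [/integrableP[_ h]|h]; first exact: h.
  apply/integrableP; split; last exact: h.
  by apply/measurable_EFinP; exact: (measurableT_comp mg mX).
have dE : (fun w => `|tr_drift M f (X w)|) = (fun w => `|drift M f (X w)|).
  by apply/funext => w; rewrite tr_driftE.
have tE : (fun w => `|tr_PsiSigma Psi Sigma f (X w)|) = (fun w => `|trace2 E Om f (X w)|).
  by apply/funext => w; rewrite (tr_PsiSigmaE hidx).
rewrite /stein_class dE tE; split=> [[_ h1 h2]|[h1 h2]].
- by split; apply/intE => //; [exact: measurable_drift|exact: measurable_trace2].
- by split=> //; apply/intE => //; [exact: measurable_drift|exact: measurable_trace2].
Qed.

Lemma stein_op_expectationE f : C2 f ->
  (P.-integrable setT (EFin \o (stein_op M Psi Sigma f \o X)) /\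
    ('E_P[stein_op M Psi Sigma f \o X] = 0)%E) <->
  (P.-integrable setT (fun w => (drift M f (st (vecs idx (X w))) +
      trace2 E Om f (st (vecs idx (X w))))%:E) /\
   (\int[P]_w (drift M f (st (vecs idx (X w))) +
      trace2 E Om f (st (vecs idx (X w))))%:E = 0)%E).
Proof.
move=> C2f; rewrite expectation.unlock.
have sE : (fun w => (drift M f (st (vecs idx (X w))) +
    trace2 E Om f (st (vecs idx (X w))))%:E) = EFin \o (stein_op M Psi Sigma f \o X).
  by apply/funext => w; rewrite of_coords_vecs// /= /stein_op tr_driftE (tr_PsiSigmaE hidx).
by rewrite sE.
Qed.

End SymmetricNormalStein.

Theorem corollary3p3 (R : realType) (d : nat) (d_gt0 : (0 < d)%N)
    (idx : 'I_(qdim d) -> 'I_d * 'I_d) (hidx : sym_ordering idx)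
    (M Psi Sigma : symmx R d)
    (hPsi : posdef Psi) (hSigma : posdef Sigma)
    (hcomm : Psi *m Sigma = Sigma *m Psi :> 'M[R]_d)
    (dZ : measure_display) (TZ : measurableType dZ) (PZ : probability TZ R)
    (Z : {RV PZ >-> symmx R d}) (hZ : has_law_SN idx Z M Psi Sigma)
    (dX : measure_display) (TX : measurableType dX) (PX : probability TX R)
    (X : {RV PX >-> symmx R d}) :
  has_law_SN idx X M Psi Sigma <->
  (forall f : symmx R d -> R, stein_class Z M Psi Sigma f ->
    PX.-integrable setT (EFin \o (stein_op M Psi Sigma f \o X)) /\
    ('E_PX[stein_op M Psi Sigma f \o X] = 0)%E).
Proof.
have x_cont := @vecs_continuous R d idx.
have xD := @vecsD R d idx.
have xZ := @vecsZ R d idx.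
have xe := @symE_coord R d idx hidx.
have xE := @vecs_expansion R d idx hidx.
have Om_sym := Omega_sym idx hPsi hSigma.
have Om_pd := Omega_posdef hidx hPsi hSigma.
have mX := measurable_vecs idx X; have mZ := measurable_vecs idx Z.
have /has_law_SN_mvn hZ' := hZ.
split=> [/has_law_SN_mvn hX f [C2f hd ht]|hX].
- have /(stein_classP hidx M hPsi hSigma Z C2f)[Id It] : stein_class Z M Psi Sigma f by [].
  apply/(stein_op_expectationE hidx M hPsi hSigma X C2f).
  (* The class speaks about Z, whereas [stein_law] is applied to X; integrability passes between
     them through the common density. *)
  have transfer (g : symmx R d -> R) : continuous g ->
      PZ.-integrable setT (fun w => (g (of_coords (symE R idx) (vecs idx (Z w))))%:E) ->
      PX.-integrable setT (fun w => (g (of_coords (symE R idx) (vecs idx (X w))))%:E).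
    move=> cg /(integrable_mvnP mZ hZ' (measurable_comp_lincomb _ cg)) h.
    exact/(integrable_mvnP mX hX (measurable_comp_lincomb _ cg)).
  apply: (stein_law x_cont xD xZ xe xE Om_sym Om_pd C2f mX hX).
    by apply: transfer Id; exact: (drift_continuous x_cont xD xZ xE).
  by apply: transfer It; exact: trace2_continuous.
- have H := stein_characterizes_law x_cont xD xZ xe xE Om_sym Om_pd mZ mX hZ'.
  (* X and Z have the same law in coordinates, and that of Z is given by its density. *)
  move=> A mA; rewrite H//; first exact: hZ.
  move=> f C2f Id It; apply/(stein_op_expectationE hidx M hPsi hSigma X C2f).
  by apply: hX; apply/(stein_classP hidx M hPsi hSigma Z C2f).
Qed.
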